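(* Let $\mu$ be a measured lamination on the unit disk $\mathbf{D}$ (with its hyperbolic metric). If $\mu=o(\delta)$, then $\mu$ is trivial, i.e. $\mu=0$.
   Context: $\mathbf{D}$ is the unit disk model of the hyperbolic plane, with metric $\frac{2|dz|}{1-|z|^2}$, and $S^1=\partial\mathbf{D}$. A geodesic lamination $\lambda$ on $\mathbf{D}$ is a closed subset $|\lambda|\subset\mathbf{D}$ together with a foliation of $|\lambda|$ by complete hyperbolic geodesics. A measured lamination $\mu$ with support $\lambda$ assigns to each closed finite hyperbolic arc $I$ a positive Radon measure on $I$ with support $I\cap|\lambda|$, invariant under homotopies which preserve the foliation of $|\lambda|$ (the homotopies need not fix the endpoints of $I$); $\mu(I)$ is its total mass. The trivial measured lamination $\mu=0$ is the one whose transverse measures all vanish. For a closed hyperbolic arc $I\subset\mathbf{D}$ of hyperbolic length $1$, $\delta(I)$ denotes the minimal Euclidean distance from $I$ to $S^1$. One writes $\mu=o(\delta)$ if $\mu(I)/\delta(I)\to0$ as $\delta(I)\to0$, uniformly in $I$; that is, for every $\epsilon>0$ there is $\eta>0$ such that $\mu(I)\leq\epsilon\,\delta(I)$ for every closed hyperbolic arc $I$ of length $1$ with $\delta(I)<\eta$.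
   Formalization: The measures on the arcs are also required to be coherent (for J inside I, the measure on J is the restriction of that on I), as is usual for transverse measures; arcs lying in a leaf carry no measure, and the support condition is relaxed at endpoints of arcs. *)

(* Defs.v *)
From HB Require Import structures.
From mathcomp Require Import all_boot all_order all_algebra.
From mathcomp Require Import all_classical all_reals all_analysis.
Set Implicit Arguments.
Unset Strict Implicit.
Unset Printing Implicit Defensive.
Import Order.TTheory GRing.Theory Num.Theory.
Import numFieldNormedType.Exports.
Local Open Scope classical_set_scope.
Local Open Scope ring_scope.

Notation plane R := (R * R)%type.

(* The plane with its Borel sigma-algebra. *)
Notation borel_plane R := (g_sigma_algebraType (@open (plane R))).

Section hyperbolic_disk.
Context {R : realType}.
Implicit Types (z w : plane R) (I L : set (plane R)) (g : R -> plane R).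

(* The library norm on R * R is the sup norm, hence this definition. *)
Definition enorm z : R := Num.sqrt (z.1 ^+ 2 + z.2 ^+ 2).

Definition disk : set (plane R) := [set z | enorm z < 1].

Definition circle : set (plane R) := [set z | enorm z = 1].

(* The path t |-> (x t, y t), 0 <= t <= 1. Asking for x and y to be C^1 on the
   whole line is no restriction: a C^1 function on [0, 1] extends. *)
Definition C1_path (x y : R -> R) (z w : plane R) : Prop :=
  [/\ (forall t : R, derivable x t 1) /\ continuous (derive1 x),
      (forall t : R, derivable y t 1) /\ continuous (derive1 y),
      (x 0, y 0) = z /\ (x 1, y 1) = w &
      forall t : R, t \in `[0, 1] -> disk (x t, y t)].

(* Length for the metric 2|dz| / (1 - |z|^2). *)
Definition hyp_length (x y : R -> R) : R :=
  (\int[lebesgue_measure]_(t in `[0%R, 1%R])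
     (2 * enorm (derive1 x t, derive1 y t) / (1 - enorm (x t, y t) ^+ 2)))%R.

Definition hyp_dist z w : R :=
  inf [set l | exists x y, C1_path x y z w /\ l = hyp_length x y].

(* g is a unit speed parametrization, on the set of times T, of a geodesic. *)
Definition unit_speed_geodesic (T : set R) g : Prop :=
  (forall t, T t -> disk (g t)) /\
  (forall s t : R, T s -> T t -> hyp_dist (g s) (g t) = `|s - t|).

Definition complete_geodesic L : Prop :=
  exists g, unit_speed_geodesic setT g /\ L = range g.

(* I is the closed geodesic arc of hyperbolic length l parametrized by g. *)
Definition arc_param (l : R) g I : Prop :=
  [/\ 0 < l, unit_speed_geodesic `[0, l] g & I = g @` `[0, l]].

Definition arc_of_length (l : R) I : Prop := exists g, arc_param l g I.

Definition hyperbolic_arc I : Prop := exists l, arc_of_length l I.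

(* Minimal Euclidean distance to the unit circle. *)
Definition delta I : R :=
  inf [set r | exists z w, [/\ I z, circle w & r = enorm (z - w)]].

Definition measure_support (m : set (borel_plane R) -> \bar R) :
    set (plane R) :=
  [set z | forall U : set (plane R), open U -> U z -> (0 < m U)%E].

End hyperbolic_disk.

(* A foliation of a closed set by complete geodesics is a partition of it into
   such geodesics: the local product structure is then automatic. *)
Record geodesic_lamination (R : realType) := GeodesicLamination {
  leaves : set (set (plane R));
  leaf_geodesic : forall L, leaves L -> complete_geodesic L;
  leaf_disjoint : trivIset leaves id;
  (* closed relatively to the open disk *)
  leaves_closed : closure (\bigcup_(L in leaves) L) `&` disk `<=`
                  \bigcup_(L in leaves) L }.

Section laminations.
Context {R : realType}.
Implicit Types (lam : geodesic_lamination R) (I J : set (plane R)).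

Definition lam_support lam : set (plane R) := \bigcup_(L in leaves lam) L.

(* A geodesic arc not contained in a leaf meets every leaf at most once. *)
Definition transverse_arc lam I : Prop :=
  hyperbolic_arc I /\ ~ (exists2 L, leaves lam L & I `<=` L).

(* H is a homotopy from I = H(0, [0,1]) to J = H(1, [0,1]): each point moves
   either inside a single leaf or off the lamination. The end points of the
   arcs are free to move. *)
Definition foliation_homotopy lam (H : R * R -> plane R) I J : Prop :=
  [/\ {within `[0, 1] `*` `[0, 1], continuous H},
      set_bij `[0, 1] I (fun s : R => H (0, s)),
      set_bij `[0, 1] J (fun s : R => H (1, s)),
      (forall t s : R, t \in `[0, 1] -> s \in `[0, 1] -> disk (H (t, s))) &
      forall s : R, s \in `[0, 1] ->
        (exists2 L, leaves lam L & forall t : R, t \in `[0, 1] -> L (H (t, s))) \/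
        (forall t : R, t \in `[0, 1] -> ~ lam_support lam (H (t, s)))].

End laminations.

(* tmeasure I is the transverse measure carried by I, extended by 0 to the
   plane; it is only meaningful when I is a transverse arc. Finite Borel
   measures on an arc are Radon.
   - tmeasure_full leaves the end points of I aside: by tmeasure_restrict, the
     measure need not charge a leaf which I only touches at an end point.
   - tmeasure_restrict says that the measures on the various arcs are the
     restrictions of one and the same transverse measure. *)
Record measured_lamination (R : realType) := MeasuredLamination {
  lamination : geodesic_lamination R;
  tmeasure : set (plane R) -> {finite_measure set (borel_plane R) -> \bar R};
  tmeasure_carrier : forall I, transverse_arc lamination I ->
    tmeasure I (~` I) = 0%E;
  tmeasure_support : forall I, transverse_arc lamination I ->
    measure_support (tmeasure I) `<=` I `&` lam_support lamination;
  tmeasure_full : forall l g I, arc_param l g I ->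
    transverse_arc lamination I ->
    g @` `]0, l[ `&` lam_support lamination `<=` measure_support (tmeasure I);
  tmeasure_restrict : forall I J, transverse_arc lamination I ->
    transverse_arc lamination J -> J `<=` I ->
    forall A : set (borel_plane R), measurable A ->
      tmeasure J A = tmeasure I (A `&` J);
  tmeasure_homotopy : forall I J H, transverse_arc lamination I ->
    transverse_arc lamination J -> foliation_homotopy lamination H I J ->
    forall A : set R, measurable A -> A `<=` `[0, 1] ->
      tmeasure I ((fun s : R => H (0, s)) @` A) =
      tmeasure J ((fun s : R => H (1, s)) @` A) }.

Section little_o.
Context {R : realType}.
Implicit Types mu : measured_lamination R.

Definition mass mu (I : set (plane R)) : \bar R := tmeasure mu I I.

Definition is_little_o_delta mu : Prop :=
  forall eps : R, 0 < eps -> exists2 eta : R, 0 < eta &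
    forall I, transverse_arc (lamination mu) I -> arc_of_length 1 I ->
      delta I < eta -> (mass mu I <= (eps * delta I)%:E)%E.

Definition trivial_lamination mu : Prop :=
  forall I, transverse_arc (lamination mu) I ->
    forall A : set (borel_plane R), measurable A -> tmeasure mu I A = 0%E.

End little_o.

(* Main.v *)
Require Import Defs.
From mathcomp Require Import all_boot all_order all_algebra.
From mathcomp Require Import all_classical all_reals all_analysis.
From mathcomp Require Import ring lra.
Set Implicit Arguments.
Unset Strict Implicit.
Unset Printing Implicit Defensive.
Import Order.TTheory GRing.Theory Num.Theory.
Import numFieldNormedType.Exports.
Local Open Scope classical_set_scope.
Local Open Scope ring_scope.

(** Let L be a leaf crossing an arc at a point x. Disjoint geodesics which cross
    the arc within r of x separate slowly: they stay at bounded distance from L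
    until hyperbolic depth about log (1 / r). Hence all leaves crossing the arc
    within r of x also cross one arc of length 1 orthogonal to L whose Euclidean
    distance to the circle is at most a constant times r. Sliding along the leaves
    preserves the transverse measure, so the measure of the neighbourhood of radius
    r of x is at most the mass of that arc, which is o(r). A measure on an
    interval whose density is zero at each point has a distribution function with
    zero derivative, so it is zero.

    The geometry takes place in the hyperboloid model. The distance of the disk is
    an infimum of lengths of paths; [hyp_dist_geo] computes it along a geodesic
    given by an orthonormal frame, the lower bound coming from a function of
    gradient at most 1 ([speed_bound]). Any two points are on such a geodesic, so
    every isometric embedding of an interval is one ([unit_speed_geodesicE]). In
    the projective [chart] of a frame, leaves are chords of the unit disk and
    orthogonal arcs are vertical segments.

    With L as the axis of a chart, nearby leaves are lines y = b + m(b) x. To slide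
    the whole arc one also has to move the points between the leaves, without ever
    meeting a leaf. As leaves do not cross, b + m(b) X' is a monotone Lipschitz
    function of b on the leaves, for X' close to the end of the axis. It has an
    extension of the same kind with values in the convex hull of its values on the
    leaves ([monotone_lipschitz_extension]), which provides lines that do not
    cross there and fill the gaps ([slope_extension]). Moving along them is the homotopy of
    [holonomy]; [zero_density] and [arc_null] conclude. *)

(** * The Lorentz form and the disk *)

Section hyperboloid.
Context {R : realType}.
Implicit Types (a b c s t x y : R) (z w : plane R).

(** Vectors (time, space, space) of the Lorentz space whose rays of negative
    square are the points of the hyperbolic plane. *)
Definition vec : Type := (R * R * R)%type.
Implicit Types (u v A B : vec).

Definition cosh t : R := (expR t + expR (- t)) / 2.
Definition sinh t : R := (expR t - expR (- t)) / 2.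

Lemma expR_mulN t : expR t * expR (- t) = 1.
Proof. by rewrite -expRD subrr expR0. Qed.

Lemma cosh_sqr t : cosh t ^+ 2 = 1 + sinh t ^+ 2.
Proof. have := expR_mulN t; rewrite /cosh /sinh => h; lra. Qed.

Lemma cosh_gt0 t : 0 < cosh t.
Proof. have := expR_gt0 t; have := expR_gt0 (- t); rewrite /cosh => h1 h2; lra. Qed.

Lemma coshD s t : cosh (s + t) = cosh s * cosh t + sinh s * sinh t.
Proof. rewrite /cosh /sinh opprD !expRD; lra. Qed.

Lemma sinhD s t : sinh (s + t) = sinh s * cosh t + cosh s * sinh t.
Proof. rewrite /cosh /sinh opprD !expRD; lra. Qed.

Lemma coshN t : cosh (- t) = cosh t.
Proof. by rewrite /cosh opprK addrC. Qed.

Lemma sinhN t : sinh (- t) = - sinh t.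
Proof. rewrite /sinh opprK; lra. Qed.

Lemma cosh0 : cosh 0 = 1.
Proof. rewrite /cosh oppr0 expR0; lra. Qed.

Lemma sinh0 : sinh 0 = 0.
Proof. by rewrite /sinh oppr0 subrr mul0r. Qed.

Lemma sinh_gt0 t : 0 < t -> 0 < sinh t.
Proof. by move=> t0; rewrite /sinh divr_gt0// subr_gt0 ltr_expR gtrN. Qed.

Lemma cosh_abs t : cosh `|t| = cosh t.
Proof. by case: (ger0P t) => // _; rewrite coshN. Qed.

Definition lor u v : R := u.1.2 * v.1.2 + u.2 * v.2 - u.1.1 * v.1.1.

(** The Euclidean vector product, with its time coordinate changed of sign so as
    to be orthogonal to both factors for the Lorentz form. *)
Definition cross A B : vec :=
  (- (A.1.2 * B.2 - A.2 * B.1.2), A.2 * B.1.1 - A.1.1 * B.2,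
   A.1.1 * B.1.2 - A.1.2 * B.1.1).

Definition scal c u : vec := (c * u.1.1, c * u.1.2, c * u.2).

Definition comb A B a b c : vec :=
  (a * A.1.1 + b * B.1.1 + c * (cross A B).1.1,
   a * A.1.2 + b * B.1.2 + c * (cross A B).1.2,
   a * A.2 + b * B.2 + c * (cross A B).2).

Definition future u : Prop := 0 < u.1.1 /\ lor u u < 0.

(** A point of the hyperboloid with a unit tangent vector at it;
    [cross A B] completes them into an orthonormal basis. *)
Definition frame A B : Prop :=
  [/\ lor A A = -1, lor B B = 1, lor A B = 0 & 0 < A.1.1].

Lemma lorC u v : lor u v = lor v u.
Proof. rewrite /lor; ring. Qed.

Lemma lor_scal c u v : lor (scal c u) v = c * lor u v.
Proof. rewrite /lor/=; ring. Qed.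

Lemma lor_comb A B a b c u :
  lor (comb A B a b c) u = a * lor A u + b * lor B u + c * lor (cross A B) u.
Proof. rewrite /lor/=; ring. Qed.

Lemma crossA A B : lor (cross A B) A = 0.
Proof. rewrite /lor/=; ring. Qed.

Lemma crossB A B : lor (cross A B) B = 0.
Proof. rewrite /lor/=; ring. Qed.

Lemma lor_cross A B :
  lor (cross A B) (cross A B) = lor A B ^+ 2 - lor A A * lor B B.
Proof. rewrite /lor/=; ring. Qed.

Lemma frame_cross A B : frame A B -> lor (cross A B) (cross A B) = 1.
Proof. move=> [hA hB hAB _]; rewrite lor_cross hA hB hAB; ring. Qed.

Lemma lor_comb2 A B a b c a' b' c' : frame A B ->
  lor (comb A B a b c) (comb A B a' b' c') = b * b' + c * c' - a * a'.
Proof.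
move=> F; have [hA hB hAB _] := F.
rewrite lor_comb !(lorC _ (comb _ _ _ _ _)) !lor_comb crossA crossB.
by rewrite (lorC A (cross _ _)) (lorC B (cross _ _)) crossA crossB
  frame_cross// (lorC B A) hA hB hAB; ring.
Qed.

(** Coordinates in an orthonormal basis. The identity behind it is the expansion
    of a vector along A, B and their vector product, valid for all A and B. *)
Lemma comb_complete A B u : frame A B ->
  u = comb A B (- lor u A) (lor u B) (lor u (cross A B)).
Proof.
move=> F; have [hA hB hAB _] := F; have hC := frame_cross F.
have key : forall i : vec -> R, (i = (fun p => p.1.1) \/ i = (fun p => p.1.2) \/
    i = (fun p => p.2)) ->
  lor (cross A B) (cross A B) * i u =
   (lor A B * lor u B - lor u A * lor B B) * i A +
   (lor A B * lor u A - lor u B * lor A A) * i B +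
   lor u (cross A B) * i (cross A B).
  by move=> i [->|[->|->]]; rewrite /lor/=; ring.
case: u key => -[u0 u1] u2 key; rewrite /comb; congr (_, _, _).
- have := key _ (or_introl erefl); rewrite hC hA hB hAB/= => h; lra.
- have := key _ (or_intror (or_introl erefl)); rewrite hC hA hB hAB/= => h; lra.
- have := key _ (or_intror (or_intror erefl)); rewrite hC hA hB hAB/= => h; lra.
Qed.

(** Cauchy-Schwarz in the space coordinates: two vectors of the future cone have a
    negative Lorentz product. *)
Lemma reversed_CS a b c a' b' c' : 0 < a -> 0 < a' ->
  b ^+ 2 + c ^+ 2 <= a ^+ 2 -> b' ^+ 2 + c' ^+ 2 < a' ^+ 2 ->
  b * b' + c * c' < a * a'.
Proof.
move=> a0 a'0 h h'.
have aa : 0 <= a * a' by rewrite mulr_ge0// ltW.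
apply: (@le_lt_trans _ _ `|b * b' + c * c'|); first exact: ler_norm.
rewrite -(ger0_norm aa) -ltr_sqr ?nnegrE// !real_normK ?num_real//.
apply: (@le_lt_trans _ _ ((b ^+ 2 + c ^+ 2) * (b' ^+ 2 + c' ^+ 2))).
  rewrite -subr_ge0 (_ : _ - _ = (b * c' - c * b') ^+ 2) ?sqr_ge0//; ring.
have [e|e] := eqVneq (b ^+ 2 + c ^+ 2) 0.
  by rewrite e mul0r exprn_gt0// mulr_gt0.
rewrite exprMn; apply: (@lt_le_trans _ _ ((b ^+ 2 + c ^+ 2) * a' ^+ 2)).
  by rewrite ltr_pM2l// lt0r e addr_ge0// sqr_ge0.
by rewrite ler_pM2r// exprn_gt0.
Qed.

(** The time axis has square -1 in any orthonormal basis. *)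
Lemma frame_time A B : frame A B ->
  A.1.1 ^+ 2 = 1 + B.1.1 ^+ 2 + (cross A B).1.1 ^+ 2.
Proof.
move=> F; pose e : vec := (1, 0, 0).
have := lor_comb2 (- lor e A) (lor e B) (lor e (cross A B))
  (- lor e A) (lor e B) (lor e (cross A B)) F.
rewrite -(comb_complete e F) /lor /e /cross/= => h; lra.
Qed.

Lemma comb_future A B a b c : frame A B -> 0 < a -> b ^+ 2 + c ^+ 2 < a ^+ 2 ->
  future (comb A B a b c).
Proof.
move=> F a0 h; have [hA hB hAB A0] := F; split; last first.
  by rewrite lor_comb2// -!expr2 subr_lt0.
have ht := frame_time F; rewrite /comb; move: (cross A B) ht => C ht.
have hBC : (- B.1.1) ^+ 2 + (- C.1.1) ^+ 2 <= A.1.1 ^+ 2.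
  by rewrite !sqrrN ht -addrA lerDr.
have := reversed_CS A0 a0 hBC h => /= h'; lra.
Qed.

Definition rad u : R := Num.sqrt (- lor u u).

(** Stereographic projection of the ray of u: with the radius in the
    denominator it does not depend on the vector chosen on the ray. *)
Definition proj u : plane R :=
  (u.1.2 / (u.1.1 + rad u), u.2 / (u.1.1 + rad u)).

(** The representative of the ray over z which is polynomial in z; its radius is
    1 - |z|^2, the denominator of the hyperbolic metric. *)
Definition lift z : vec := (1 + (z.1 ^+ 2 + z.2 ^+ 2), 2 * z.1, 2 * z.2).

Lemma rad_sqr u : future u -> rad u ^+ 2 = - lor u u.
Proof. by move=> [_ h]; rewrite sqr_sqrtr// oppr_ge0 ltW. Qed.

Lemma rad_gt0 u : future u -> 0 < rad u.
Proof. by move=> [_ h]; rewrite sqrtr_gt0 oppr_gt0. Qed.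

Lemma diskE z : disk z <-> z.1 ^+ 2 + z.2 ^+ 2 < 1.
Proof.
rewrite /disk/= /enorm; have h : 0 <= z.1 ^+ 2 + z.2 ^+ 2 by rewrite addr_ge0// sqr_ge0.
by rewrite -{1}(@sqrtr1 R) ltr_sqrt.
Qed.

Lemma lor_lift z : lor (lift z) (lift z) = - (1 - (z.1 ^+ 2 + z.2 ^+ 2)) ^+ 2.
Proof. rewrite /lor/=; ring. Qed.

Lemma lift_future z : disk z -> future (lift z).
Proof.
move=> /diskE h; split=> /=; first by have := sqr_ge0 z.1; have := sqr_ge0 z.2; lra.
by rewrite lor_lift oppr_lt0 exprn_gt0// subr_gt0.
Qed.

Lemma rad_lift z : disk z -> rad (lift z) = 1 - (z.1 ^+ 2 + z.2 ^+ 2).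
Proof.
by move=> /diskE h; rewrite /rad lor_lift opprK sqrtr_sqr gtr0_norm// subr_gt0.
Qed.

Lemma proj_lift z : disk z -> proj (lift z) = z.
Proof.
move=> h; rewrite /proj rad_lift//= (_ : 1 + _ + _ = 2); last by ring.
by case: z h => a b _ /=; congr (_, _); field.
Qed.

Lemma proj_norm u : future u ->
  1 - ((proj u).1 ^+ 2 + (proj u).2 ^+ 2) = 2 * rad u / (u.1.1 + rad u).
Proof.
move=> fu; have r0 := rad_gt0 fu; have r2 := rad_sqr fu; case: fu => u0 _.
have d0 : u.1.1 + rad u != 0 by rewrite gt_eqF// addr_gt0.
rewrite /= !expr_div_n -mulrDl.
have -> : u.1.2 ^+ 2 + u.2 ^+ 2 = (u.1.1 - rad u) * (u.1.1 + rad u).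
  by move: r2; rewrite /lor => r2; lra.
by field.
Qed.

Lemma proj_disk u : future u -> disk (proj u).
Proof.
move=> fu; apply/diskE; rewrite -subr_gt0 proj_norm//.
have r0 := rad_gt0 fu; case: fu => u0 _.
by rewrite divr_gt0 ?addr_gt0// mulr_gt0.
Qed.

Lemma lift_proj u : future u -> lift (proj u) = scal (2 / (u.1.1 + rad u)) u.
Proof.
move=> fu; have h := proj_norm fu; have r0 := rad_gt0 fu; case: fu => u0 _.
have d0 : u.1.1 + rad u != 0 by rewrite gt_eqF// addr_gt0.
rewrite /lift /scal; congr (_, _, _).
- have -> : 1 + ((proj u).1 ^+ 2 + (proj u).2 ^+ 2) = 2 - 2 * rad u / (u.1.1 + rad u).
    by rewrite -h; ring.
  by field.
- by rewrite /=; field.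
- by rewrite /=; field.
Qed.

Lemma proj_scal c u : 0 < c -> proj (scal c u) = proj u.
Proof.
move=> c0; rewrite /proj /rad lor_scal lorC lor_scal -mulrN -mulrN mulrA -expr2.
rewrite sqrtrM ?sqr_ge0// sqrtr_sqr gtr0_norm//= -mulrDr.
by congr (_, _); rewrite invfM mulrACA divff ?gt_eqF// mul1r.
Qed.

End hyperboloid.
Arguments vec R : clear implicits.

(** * The distance between two points of a geodesic *)

Section calculus.
Context {R : realType}.
Implicit Types (f g : R -> R) (t : R).

Lemma is_derive_const (c t : R) : is_derive t 1 (fun=> c) 0.
Proof. exact: is_derive_cst. Qed.

Lemma is_derive_add f g t (f' g' : R) : is_derive t 1 f f' -> is_derive t 1 g g' ->
  is_derive t 1 (fun s => f s + g s) (f' + g').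
Proof. by move=> hf hg; exact: is_deriveD. Qed.

Lemma is_derive_opp f t (f' : R) : is_derive t 1 f f' -> is_derive t 1 (fun s => - f s) (- f').
Proof. by move=> hf; exact: is_deriveN. Qed.

Lemma is_derive_mul f g t (f' g' : R) : is_derive t 1 f f' -> is_derive t 1 g g' ->
  is_derive t 1 (fun s => f s * g s) (f' * g t + f t * g').
Proof.
move=> hf hg; have := is_deriveM hf hg => h; apply: is_derive_eq h _.
by rewrite /GRing.scale/= addrC (mulrC (g t)).
Qed.

Lemma is_derive_scal (c : R) f t (f' : R) : is_derive t 1 f f' ->
  is_derive t 1 (fun s => c * f s) (c * f').
Proof.
move=> hf; have h := is_derive_mul (is_derive_const c t) hf; apply: is_derive_eq h _.
by rewrite mul0r add0r.
Qed.

Lemma is_derive_inv f t (f' : R) : f t != 0 -> is_derive t 1 f f' ->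
  is_derive t 1 (fun s => (f s)^-1) (- f' / f t ^+ 2).
Proof.
move=> f0 hf; have h := is_deriveV f0 hf; apply: is_derive_eq h _.
by rewrite /GRing.scale/= mulNr mulNr mulrC.
Qed.

Lemma is_derive_ln f t (f' : R) : 0 < f t -> is_derive t 1 f f' ->
  is_derive t 1 (fun s => ln (f s)) (f' / f t).
Proof.
move=> f0 hf; have h := is_derive1_comp (is_derive1_ln f0) hf.
by apply: is_derive_eq h _; rewrite mulrC.
Qed.

Lemma is_derive_cosh t : is_derive t 1 (@cosh R) (sinh t).
Proof.
have hN : is_derive t 1 (fun s : R => expR (- s)) (- expR (- t)).
  have h := is_derive1_comp (is_derive_expR (- t)) (is_derive_opp (is_derive_id t 1)).
  by apply: is_derive_eq h _; rewrite mulrN1.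
have h := is_derive_mul (is_derive_add (is_derive_expR t) hN) (is_derive_const 2^-1 t).
by apply: is_derive_eq h _; rewrite mulr0 addr0.
Qed.

Lemma is_derive_sinh t : is_derive t 1 (@sinh R) (cosh t).
Proof.
have hN : is_derive t 1 (fun s : R => expR (- s)) (- expR (- t)).
  have h := is_derive1_comp (is_derive_expR (- t)) (is_derive_opp (is_derive_id t 1)).
  by apply: is_derive_eq h _; rewrite mulrN1.
have h := is_derive_mul (is_derive_add (is_derive_expR t) (is_derive_opp hN)) (is_derive_const 2^-1 t).
by apply: is_derive_eq h _; rewrite mulr0 addr0 opprK.
Qed.

Lemma is_derive_continuous f t (f' : R) : is_derive t 1 f f' -> {for t, continuous f}.
Proof.
by move=> [h _]; apply: differentiable_continuous; apply/derivable1_diffP.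
Qed.

Lemma itv01_continuous f : (forall t, t \in `[0, 1] -> {for t, continuous f}) ->
  {within `[0, 1], continuous f}.
Proof. by move=> h; apply: continuous_in_subspaceT => t; rewrite inE/= => ?; exact: h. Qed.

Lemma integral_lower f G g :
  (forall t, t \in `[0, 1] -> is_derive t 1 G (g t)) ->
  (forall t, t \in `[0, 1] -> {for t, continuous g}) ->
  (forall t, t \in `[0, 1] -> {for t, continuous f}) ->
  (forall t, t \in `[0, 1] -> `|g t| <= f t) ->
  `|G 1 - G 0| <= (\int[lebesgue_measure]_(t in `[0%R, 1%R]) f t)%R.
Proof.
move=> dG cg cf gf.
have ig : lebesgue_measure.-integrable `[0, 1] (EFin \o g).
  by apply: continuous_compact_integrable;
    [exact: segment_compact|exact: itv01_continuous].
have if_ : lebesgue_measure.-integrable `[0, 1] (EFin \o f).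
  by apply: continuous_compact_integrable;
    [exact: segment_compact|exact: itv01_continuous].
have eG : (\int[lebesgue_measure]_(t in `[0%R, 1%R]) g t)%R = G 1 - G 0.
  have dF : derivable_oo_LRcontinuous G 0 1.
    split.
    - by move=> t /subset_itv_oo_cc t01; have [] := dG t t01.
    - by apply: cvg_at_right_filter; apply: is_derive_continuous (dG _ _); rewrite in_itv/= lexx ler01.
    - by apply: cvg_at_left_filter; apply: is_derive_continuous (dG _ _); rewrite in_itv/= lexx ler01.
  rewrite /Rintegral (continuous_FTC2 ltr01 (itv01_continuous cg) dF)//.
  by move=> t /subset_itv_oo_cc t01; rewrite derive1E; have [_ ->] := dG t t01.
rewrite -eG; apply: (le_trans (le_normr_Rintegral _ ig)) => //.
apply: le_Rintegral => //; first by apply: integrable_norm ig.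
Qed.

End calculus.

Section hyperbolic_distance.
Context {R : realType}.
Implicit Types (a b c s t : R) (z w : plane R) (u v A B p : vec R).

(** The unit speed geodesic of the frame: a branch of hyperbola, projected. *)
Definition geo A B t : plane R := proj (comb A B (cosh t) (sinh t) 0).

Lemma cosh_sinh_lt s : sinh s ^+ 2 + 0 ^+ 2 < cosh s ^+ 2 :> R.
Proof. by rewrite cosh_sqr expr0n/= addr0 ltrDr. Qed.

Lemma geo_future A B t : frame A B -> future (comb A B (cosh t) (sinh t) 0).
Proof. by move=> F; apply: comb_future => //; [exact: cosh_gt0|exact: cosh_sinh_lt]. Qed.

Lemma geo_disk A B t : frame A B -> disk (geo A B t).
Proof. by move=> F; exact/proj_disk/geo_future. Qed.

(** For b = a or b = - a the vector aA + bB is null: it is an end of the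
    geodesic. Its product with a point of the disk is the factor whose logarithm
    is the Busemann function of that end. *)
Lemma comb_pos A B a b z : frame A B -> 0 < a -> b ^+ 2 = a ^+ 2 -> disk z ->
  0 < - lor (lift z) (comb A B a b 0).
Proof.
move=> F a0 hab hz; have [_ hB hAB A0] := F.
set p := comb _ _ _ _ _; have hpp : lor p p = 0 by rewrite lor_comb2//; lra.
have ht := frame_time F.
have hBA : `|B.1.1| < A.1.1.
  rewrite -ltr_sqr ?nnegrE ?normr_ge0 ?ltW// real_normK ?num_real// ht.
  by have := sqr_ge0 (cross A B).1.1; lra.
have p0 : 0 < p.1.1.
  have hb : `|b| = a.
    by apply/eqP; rewrite -(@eqrXn2 _ 2)// ?ltW// real_normK ?num_real//; apply/eqP.
  have h1 : `|b * B.1.1| < a * A.1.1 by rewrite normrM hb ltr_pM2l.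
  rewrite /p /comb/= mul0r addr0; move: h1; rewrite ltr_norml => /andP[h1 _]; lra.
have [l0 lt] := lift_future hz.
have /= := @reversed_CS _ p.1.1 p.1.2 p.2 (lift z).1.1 (lift z).1.2 (lift z).2 p0 l0.
move: hpp lt; rewrite {1 2}/lor => h1 h2.
have e1 : p.1.2 ^+ 2 + p.2 ^+ 2 <= p.1.1 ^+ 2 by lra.
have e2 : (lift z).1.2 ^+ 2 + (lift z).2 ^+ 2 < (lift z).1.1 ^+ 2 by lra.
move=> /(_ e1 e2) h3; rewrite /lor/=; move: h3; rewrite /=; lra.
Qed.

Lemma is_derive_lift (x y : R -> R) t (x' y' : R) p :
  is_derive t 1 x x' -> is_derive t 1 y y' ->
  is_derive t 1 (fun s => - lor (lift (x s, y s)) p)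
   (- lor (2 * (x t * x' + y t * y'), 2 * x', 2 * y') p).
Proof.
move=> hx hy.
have hl : is_derive t 1 (fun s => p.1.1 * (1 + (x s * x s + y s * y s)) +
   (- (2 * p.1.2) * x s + - (2 * p.2) * y s))
   (p.1.1 * (0 + ((x' * x t + x t * x') + (y' * y t + y t * y'))) +
   (- (2 * p.1.2) * x' + - (2 * p.2) * y')).
  exact: (is_derive_add (is_derive_scal _ (is_derive_add (is_derive_const _ _) (is_derive_add (is_derive_mul hx hx) (is_derive_mul hy hy))))
               (is_derive_add (is_derive_scal _ hx) (is_derive_scal _ hy))).
have -> : (fun s => - lor (lift (x s, y s)) p) = (fun s => p.1.1 * (1 + (x s * x s + y s * y s)) +
   (- (2 * p.1.2) * x s + - (2 * p.2) * y s)).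
  by apply/funext => s; rewrite /lor/=; ring.
by apply: is_derive_eq hl _; rewrite /lor/=; ring.
Qed.

(** The difference of the Busemann functions of the two ends of a geodesic has
    gradient at most the hyperbolic metric: with (al, be, ga) the coordinates of
    the lift in the basis (A, B, cross A B), its derivative is
    (be' al - al' be) / (ga^2 + q^2), and Lagrange's identity shows that the
    square of the numerator is 4 |z'|^2 (ga^2 + q^2) minus a square. *)
Lemma speed_bound A B z (x' y' : R) (l' := (2 * (z.1 * x' + z.2 * y'), 2 * x', 2 * y'))
    (N := fun u => - lor u (comb A B 1 (-1) 0)) (M := fun u => - lor u (comb A B 1 1 0)) :
  frame A B -> disk z ->
  `|2^-1 * (N l' / N (lift z) - M l' / M (lift z))| <=
    2 * enorm (x', y') / (1 - enorm z ^+ 2).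
Proof.
move=> F hz.
have hn : 0 < 1 - (z.1 ^+ 2 + z.2 ^+ 2) by rewrite subr_gt0; apply/diskE.
have en w : enorm w ^+ 2 = w.1 ^+ 2 + w.2 ^+ 2.
  by rewrite sqr_sqrtr// addr_ge0// sqr_ge0.
have N0 : 0 < N (lift z) by apply: comb_pos => //; rewrite ?sqrrN.
have M0 : 0 < M (lift z) by apply: comb_pos.
set al := - lor (lift z) A; set be := lor (lift z) B.
set ga := lor (lift z) (cross A B).
set al' := - lor l' A; set be' := lor l' B; set ga' := lor l' (cross A B).
set q := 1 - (z.1 ^+ 2 + z.2 ^+ 2).
have eN : N (lift z) = al + be.
  by rewrite /N /al /be lorC lor_comb !(lorC (lift z)); ring.
have eM : M (lift z) = al - be.
  by rewrite /M /al /be lorC lor_comb !(lorC (lift z)); ring.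
have eN' : N l' = al' + be'.
  by rewrite /N /al' /be' lorC lor_comb !(lorC l'); ring.
have eM' : M l' = al' - be'.
  by rewrite /M /al' /be' lorC lor_comb !(lorC l'); ring.
have hl : lift z = comb A B al be ga := comb_complete _ F.
have hl' : l' = comb A B al' be' ga' := comb_complete _ F.
have h1 : be ^+ 2 + ga ^+ 2 - al ^+ 2 = - q ^+ 2.
  by have := lor_comb2 al be ga al be ga F; rewrite -hl lor_lift => ->; ring.
have h2 : be' ^+ 2 + ga' ^+ 2 - al' ^+ 2 =
    4 * (x' ^+ 2 + y' ^+ 2) - (2 * (z.1 * x' + z.2 * y')) ^+ 2.
  have := lor_comb2 al' be' ga' al' be' ga' F; rewrite -hl' !expr2 => <-.
  by rewrite /lor/l'/=; ring.
have h3 : be * be' + ga * ga' - al * al' = q * (2 * (z.1 * x' + z.2 * y')).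
  have := lor_comb2 al be ga al' be' ga' F; rewrite -hl -hl' => <-.
  by rewrite /lor/l' /q/=; ring.
move: h2 h3; set q' := 2 * (_ + _) => h2 h3.
rewrite eN eM eN' eM'; rewrite eN in N0; rewrite eM in M0.
have e2 : 2^-1 * ((al' + be') / (al + be) - (al' - be') / (al - be)) =
    (be' * al - al' * be) / (al ^+ 2 - be ^+ 2).
  by field; rewrite !gt_eqF// subr_sqr mulr_gt0.
have D0 : 0 < al ^+ 2 - be ^+ 2 by rewrite subr_sqr mulr_gt0.
rewrite e2 en -/q normrM normfV (gtr0_norm D0) ler_pdivrMr//.
have q0 : 0 < q by [].
set e := enorm _; have e0 : 0 <= e by rewrite sqrtr_ge0.
have ee : e ^+ 2 = x' ^+ 2 + y' ^+ 2 by rewrite en.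
have rhs0 : 0 <= 2 * e / q * (al ^+ 2 - be ^+ 2).
  by rewrite mulr_ge0 ?(ltW D0)// divr_ge0 ?(ltW q0)// mulr_ge0.
rewrite -(ger0_norm rhs0) -ler_sqr ?nnegrE// !real_normK ?num_real//.
have D1 : al ^+ 2 - be ^+ 2 = ga ^+ 2 + q ^+ 2 by lra.
rewrite D1 in D0 *.
have hP : (be' * al - al' * be) ^+ 2 =
    4 * e ^+ 2 * (ga ^+ 2 + q ^+ 2) - (ga * q' + q * ga') ^+ 2.
  have -> : (be' * al - al' * be) ^+ 2 = (al * al' - be * be') ^+ 2
    - (al ^+ 2 - be ^+ 2) * (al' ^+ 2 - be' ^+ 2) by ring.
  have -> : al * al' - be * be' = ga * ga' - q * q' by lra.
  have -> : al' ^+ 2 - be' ^+ 2 = ga' ^+ 2 + q' ^+ 2 - 4 * e ^+ 2 by rewrite ee; lra.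
  by rewrite D1; ring.
apply: (@le_trans _ _ (4 * e ^+ 2 * (ga ^+ 2 + q ^+ 2))).
  by rewrite hP gerBl sqr_ge0.
rewrite (_ : (2 * e / q * (ga ^+ 2 + q ^+ 2)) ^+ 2 =
  4 * e ^+ 2 * (ga ^+ 2 + q ^+ 2) * ((ga ^+ 2 + q ^+ 2) / q ^+ 2)); last first.
  by field; rewrite gt_eqF.
apply: ler_peMr; first by rewrite mulr_ge0 ?(ltW D0)// mulr_ge0// sqr_ge0.
by rewrite ler_pdivlMr ?exprn_gt0// mul1r lerDr sqr_ge0.
Qed.

End hyperbolic_distance.

Section hyperbolic_distance2.
Context {R : realType}.
Implicit Types (a b c s t : R) (z w : plane R) (u v A B p : vec R).

(** Half the difference of the Busemann functions of the two ends of a geodesic: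
    arc length along the geodesic, extended to the disk by orthogonal
    projection. *)
Definition busemann_diff A B z : R :=
  2^-1 * (ln (- lor (lift z) (comb A B 1 (-1) 0)) - ln (- lor (lift z) (comb A B 1 1 0))).

Lemma busemann_diff_geo A B t : frame A B -> busemann_diff A B (geo A B t) = t.
Proof.
move=> F; rewrite /busemann_diff /geo lift_proj; last exact: geo_future.
have fu := geo_future t F; have r0 := rad_gt0 fu; case: fu => u0 _.
have : 0 < 2 / ((comb A B (cosh t) (sinh t) 0).1.1 + rad (comb A B (cosh t) (sinh t) 0)).
  by rewrite divr_gt0// addr_gt0.
set c := 2 / _; move: c => c c0.
rewrite !lor_scal !lor_comb2//.
have -> : - (c * (sinh t * -1 + 0 * 0 - cosh t * 1)) = c * expR t.
  by rewrite /cosh /sinh; lra.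
have -> : - (c * (sinh t * 1 + 0 * 0 - cosh t * 1)) = c * expR (- t).
  by rewrite /cosh /sinh; lra.
rewrite !lnM ?posrE ?expR_gt0// !expRK; lra.
Qed.

Lemma continuous_mul (f g : R -> R) t : {for t, continuous f} ->
  {for t, continuous g} -> {for t, continuous (fun s => f s * g s)}.
Proof. by move=> hf hg; apply: cvgM. Qed.

Lemma continuous_add (f g : R -> R) t : {for t, continuous f} ->
  {for t, continuous g} -> {for t, continuous (fun s => f s + g s)}.
Proof. by move=> hf hg; apply: cvgD. Qed.

Lemma continuous_opp (f : R -> R) t : {for t, continuous f} ->
  {for t, continuous (fun s => - f s)}.
Proof. by move=> hf; apply: cvgN. Qed.

Lemma continuous_inv (f : R -> R) t : f t != 0 -> {for t, continuous f} ->
  {for t, continuous (fun s => (f s)^-1)}.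
Proof. by move=> f0 hf; apply: cvgV. Qed.

Lemma continuous_const c t : {for t, continuous (fun=> c)}.
Proof. exact: cvg_cst. Qed.

Lemma enormE z : enorm z = Num.sqrt (z.1 * z.1 + z.2 * z.2).
Proof. by rewrite /enorm !expr2. Qed.

Lemma continuous_enorm (f g : R -> R) t : {for t, continuous f} ->
  {for t, continuous g} -> {for t, continuous (fun s => enorm (f s, g s))}.
Proof.
move=> hf hg; rewrite (_ : (fun s => _) =
  (fun s => Num.sqrt (f s * f s + g s * g s))); last first.
  by apply/funext => s; rewrite enormE.
apply: continuous_comp; last exact: sqrt_continuous.
by apply: continuous_add; exact: continuous_mul.
Qed.

Lemma C1_path_lower A B s t x y : frame A B ->
  C1_path x y (geo A B s) (geo A B t) -> `|t - s| <= hyp_length x y.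
Proof.
move=> F [[dx cx] [dy cy] [e0 e1] hd].
have hx (r : R) : is_derive r 1 x (derive1 x r) by rewrite derive1E; exact/derivableP.
have hy (r : R) : is_derive r 1 y (derive1 y r) by rewrite derive1E; exact/derivableP.
have kx (r : R) : {for r, continuous x} := is_derive_continuous (hx r).
have ky (r : R) : {for r, continuous y} := is_derive_continuous (hy r).
have kx' (r : R) : {for r, continuous (derive1 x)} := cx r.
have ky' (r : R) : {for r, continuous (derive1 y)} := cy r.
(* e = -1 and e = 1 stand for the two ends of the geodesic *)
pose N e (r : R) := - lor (lift (x r, y r)) (comb A B 1 e 0).
pose N' e (r : R) := - lor (2 * (x r * derive1 x r + y r * derive1 y r),
  2 * derive1 x r, 2 * derive1 y r) (comb A B 1 e 0).
have dN e (r : R) : is_derive r 1 (N e) (N' e r) by exact: is_derive_lift.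
have N0 e (r : R) : e ^+ 2 = 1 -> r \in `[0, 1] -> 0 < N e r.
  by move=> e12 r01; apply: comb_pos => //; [rewrite expr1n|exact: hd].
pose g (r : R) := 2^-1 * (N' (-1) r / N (-1) r - N' 1 r / N 1 r).
have cN' e (r : R) : {for r, continuous (N' e)}.
  have -> : N' e = (fun r => (2 * (comb A B 1 e 0).1.1) * (x r * derive1 x r + y r * derive1 y r) +
     (- (2 * (comb A B 1 e 0).1.2) * derive1 x r + - (2 * (comb A B 1 e 0).2) * derive1 y r)).
    by apply/funext => q; rewrite /N' /lor/=; ring.
  by apply: continuous_add; [apply: continuous_mul;[exact: continuous_const|
    apply: continuous_add; exact: continuous_mul]|apply: continuous_add;
    apply: continuous_mul => //; exact: continuous_const].
have -> : t - s = busemann_diff A B (x 1, y 1) - busemann_diff A B (x 0, y 0).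
  by rewrite e0 e1 !busemann_diff_geo.
apply: (@integral_lower R _ (fun r => busemann_diff A B (x r, y r)) g) => r r01.
- have h1 := is_derive_ln (N0 (-1) r ltac:(by rewrite sqrrN expr1n) r01) (dN (-1) r).
  have h2 := is_derive_ln (N0 1 r ltac:(by rewrite expr1n) r01) (dN 1 r).
  exact: (is_derive_scal _ (is_derive_add h1 (is_derive_opp h2))).
- apply: continuous_mul; first exact: continuous_const.
  apply: continuous_add; last apply: continuous_opp;
   (apply: continuous_mul; first exact: cN'); apply: continuous_inv;
   rewrite ?gt_eqF ?N0 ?sqrrN ?expr1n//; exact: is_derive_continuous (dN _ _).
- apply: continuous_mul.
    apply: continuous_mul; first exact: continuous_const.
    exact: continuous_enorm.
  apply: continuous_inv.
    rewrite gt_eqF// sqr_sqrtr ?addr_ge0 ?sqr_ge0// subr_gt0.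
    by apply/diskE; exact: hd.
  apply: continuous_add; first exact: continuous_const.
  by apply: continuous_opp; apply: continuous_mul; exact: continuous_enorm.
- exact: (speed_bound _ _ F (hd r r01)).
Qed.

Lemma geo_rad A B t : frame A B -> rad (comb A B (cosh t) (sinh t) 0) = 1.
Proof.
move=> F; rewrite /rad lor_comb2// -!expr2 cosh_sqr.
by rewrite (_ : - _ = 1) ?sqrtr1//; ring.
Qed.

(** The geodesic arc itself, run with constant speed, has the expected length.
    The hyperbola is parametrized by all real times, whence a path that is C^1 on
    the whole line. *)
Lemma C1_path_geo A B s t : frame A B -> exists x y,
  C1_path x y (geo A B s) (geo A B t) /\ hyp_length x y = `|t - s|.
Proof.
move=> F.
pose l := t - s.
pose gv r := comb A B (cosh r) (sinh r) 0.
pose Y (i : vec R -> R) (r : R) := i A * cosh (s + l * r) + i B * sinh (s + l * r).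
pose Y' (i : vec R -> R) (r : R) := l * (i A * sinh (s + l * r) + i B * cosh (s + l * r)).
have dY i (r : R) : is_derive r 1 (Y i) (Y' i r).
  have d0 : is_derive r 1 (fun r : R => s + l * r) l.
    apply: (is_derive_eq (is_derive_add (is_derive_const s r) (is_derive_scal l (is_derive_id r 1)))).
    by rewrite mulr1 add0r.
  have h1 := @is_derive1_comp _ (@cosh R) (fun r => s + l * r) r _ _ (is_derive_cosh _) d0.
  have h2 := @is_derive1_comp _ (@sinh R) (fun r => s + l * r) r _ _ (is_derive_sinh _) d0.
  apply: (is_derive_eq (is_derive_add (is_derive_scal (i A) h1) (is_derive_scal (i B) h2))).
  by rewrite /Y'; ring.
have dY' i (r : R) : is_derive r 1 (Y' i) (l * (l * Y i r)).
  have d0 : is_derive r 1 (fun r : R => s + l * r) l.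
    apply: (is_derive_eq (is_derive_add (is_derive_const s r) (is_derive_scal l (is_derive_id r 1)))).
    by rewrite mulr1 add0r.
  have h1 := @is_derive1_comp _ (@cosh R) (fun r => s + l * r) r _ _ (is_derive_cosh _) d0.
  have h2 := @is_derive1_comp _ (@sinh R) (fun r => s + l * r) r _ _ (is_derive_sinh _) d0.
  apply: (is_derive_eq (is_derive_scal l (is_derive_add (is_derive_scal (i A) h2) (is_derive_scal (i B) h1)))).
  by rewrite /Y; ring.
pose i0 : vec R -> R := fun u => u.1.1.
pose i1 : vec R -> R := fun u => u.1.2.
pose i2 : vec R -> R := fun u => u.2.
have eY i (r : R) : i = i0 \/ i = i1 \/ i = i2 -> Y i r = i (gv (s + l * r)).
  by move=> [->|[->|->]]; rewrite /Y /gv /comb /i0 /i1 /i2/= mul0r addr0; ring.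
have Y0 (r : R) : 0 < 1 + Y i0 r.
  by rewrite eY; [rewrite addr_gt0//; have [] := geo_future (s + l * r) F|left].
have egeo (r : R) : geo A B (s + l * r) = (Y i1 r / (1 + Y i0 r), Y i2 r / (1 + Y i0 r)).
  rewrite /geo -/(gv _) /proj geo_rad// (addrC _ 1).
  by rewrite !eY//; tauto.
pose D i (r : R) := (Y' i r * (1 + Y i0 r) - Y i r * Y' i0 r) / (1 + Y i0 r) ^+ 2.
have dx i (r : R) : is_derive r 1 (fun r => Y i r / (1 + Y i0 r)) (D i r).
  have hn : 1 + Y i0 r != 0 by rewrite gt_eqF.
  apply: (is_derive_eq (is_derive_mul (dY i r) (@is_derive_inv _ (fun r => 1 + Y i0 r) r _ hn (is_derive_add (is_derive_const 1 r) (dY i0 r))))).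
  by rewrite /D; field.
have dD i : derive1 (fun r => Y i r / (1 + Y i0 r)) = D i.
  by apply/funext => r; rewrite derive1E; have [_ ->] := dx i r.
have cD i : continuous (D i).
  move=> r; have cY j q : {for q, continuous (Y j)} := is_derive_continuous (dY j q).
  have cY' j q : {for q, continuous (Y' j)} := is_derive_continuous (dY' j q).
  have c1 : {for r, continuous (fun r => 1 + Y i0 r)}.
    exact: continuous_add (@continuous_const 1 r) (cY i0 r).
  have cn := continuous_add (continuous_mul (cY' i r) c1)
    (continuous_opp (continuous_mul (cY i r) (cY' i0 r))).
  have := continuous_mul cn (@continuous_inv (fun r => (1 + Y i0 r) * (1 + Y i0 r)) r _
     (continuous_mul c1 c1)).
  apply; by rewrite mulf_neq0 ?gt_eqF.
exists (fun r => Y i1 r / (1 + Y i0 r)), (fun r => Y i2 r / (1 + Y i0 r)); split.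
  split.
  - by split; [move=> r; have [] := dx i1 r|rewrite dD; exact: cD].
  - by split; [move=> r; have [] := dx i2 r|rewrite dD; exact: cD].
  - by split; rewrite -egeo ?mulr0 ?addr0// mulr1 /l addrC subrK.
  - by move=> r _; rewrite -egeo; exact: geo_disk.
rewrite /hyp_length (@eq_Rintegral _ _ _ _ _ (fun=> `|l|)); last first.
  move=> r _; rewrite !dD -egeo.
  have hg := geo_future (s + l * r) F.
  have en : 1 - enorm (geo A B (s + l * r)) ^+ 2 = 2 / (1 + Y i0 r).
    rewrite sqr_sqrtr ?addr_ge0 ?sqr_ge0// proj_norm//.
    by rewrite -/(gv _) geo_rad// mulr1 (addrC _ 1) eY//; left.
  have hn : 1 + Y i0 r != 0 by rewrite gt_eqF.
  have enD : enorm (D i1 r, D i2 r) = `|l| / (1 + Y i0 r).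
    rewrite /enorm (_ : _ + _ = (l / (1 + Y i0 r)) ^+ 2).
      by rewrite sqrtr_sqr normrM normfV (gtr0_norm (Y0 r)).
    have h1 : Y i1 r ^+ 2 + Y i2 r ^+ 2 = Y i0 r ^+ 2 - 1.
      have := geo_rad (s + l * r) F => /(congr1 (fun x => x ^+ 2)).
      rewrite rad_sqr// expr1n /lor !eY; try tauto.
      by rewrite /i0 /i1 /i2 /gv => h; lra.
    pose W := comb A B (l * sinh (s + l * r)) (l * cosh (s + l * r)) 0.
    have eW i : i = i0 \/ i = i1 \/ i = i2 -> Y' i r = i W.
      by move=> [->|[->|->]]; rewrite /Y' /W /comb /i0 /i1 /i2/= mul0r addr0; ring.
    have h2 : Y' i1 r ^+ 2 + Y' i2 r ^+ 2 = Y' i0 r ^+ 2 + l ^+ 2.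
      have : lor W W = l ^+ 2.
        rewrite lor_comb2//.
        have -> : l ^+ 2 = l ^+ 2 * (cosh (s + l * r) ^+ 2 - sinh (s + l * r) ^+ 2).
          by rewrite cosh_sqr addrK mulr1.
        by ring.
      rewrite !eW; try tauto; rewrite /lor /i0 /i1 /i2 => h; lra.
    have h3 : Y i1 r * Y' i1 r + Y i2 r * Y' i2 r = Y i0 r * Y' i0 r.
      have : lor (gv (s + l * r)) W = 0 by rewrite lor_comb2//; ring.
      rewrite !eW ?eY; try tauto; rewrite /lor /i0 /i1 /i2 => h; lra.
    rewrite /D /=.
    move: (Y i0 r) (Y i1 r) (Y i2 r) (Y' i0 r) (Y' i1 r) (Y' i2 r) hn h1 h2 h3
      => y0 y1 y2 z0 z1 z2 hn h1 h2 h3.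
    have -> : ((z1 * (1 + y0) - y1 * z0) / (1 + y0) ^+ 2) ^+ 2 +
      ((z2 * (1 + y0) - y2 * z0) / (1 + y0) ^+ 2) ^+ 2 =
      ((z1 ^+ 2 + z2 ^+ 2) * (1 + y0) ^+ 2 - 2 * (1 + y0) * z0 * (y1 * z1 + y2 * z2)
       + (y1 ^+ 2 + y2 ^+ 2) * z0 ^+ 2) / (1 + y0) ^+ 4 by field.
    by rewrite h1 h2 h3; field.
  rewrite enD en; field; exact: hn.
rewrite Rintegral_cst//= lebesgue_measure_itv/= lte_fin ltr01 -EFinD/=.
by rewrite subr0 mulr1.
Qed.

Lemma hyp_dist_geo A B s t : frame A B ->
  hyp_dist (geo A B s) (geo A B t) = `|s - t|.
Proof.
move=> F; rewrite distrC; apply/eqP; rewrite eq_le; apply/andP; split.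
  apply: ge_inf.
    exists 0 => _ [x [y [h ->]]].
    by apply: le_trans (C1_path_lower F h).
  by have [x [y [h <-]]] := C1_path_geo s t F; exists x, y.
apply: lb_le_inf.
  by have [x [y [h _]]] := C1_path_geo s t F; exists (hyp_length x y), x, y.
by move=> _ [x [y [h ->]]]; exact: (C1_path_lower F h).
Qed.

End hyperbolic_distance2.

(** * Geodesics are projected hyperbolas *)

Section rigidity.
Context {R : realType}.
Implicit Types (a b c s t x y : R) (z w : plane R) (u v A B p : vec R).

(** The point of the hyperboloid over z. *)
Definition unit_lift z : vec R := scal (1 - (z.1 ^+ 2 + z.2 ^+ 2))^-1 (lift z).

Lemma lor_lt0 u v : future u -> future v -> lor u v < 0.
Proof.
rewrite /future /lor => -[u0 hu] [v0 hv].
have := @reversed_CS _ _ u.1.2 u.2 _ v.1.2 v.2 u0 v0.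
move=> /(_ ltac:(lra) ltac:(lra)); lra.
Qed.

Lemma future_scal c u : 0 < c -> future u -> future (scal c u).
Proof.
move=> c0 [u0 hu]; split; first by rewrite /= mulr_gt0.
by rewrite lor_scal lorC lor_scal pmulr_rlt0// pmulr_rlt0.
Qed.

Lemma unit_lift_future z : disk z -> future (unit_lift z).
Proof.
move=> hz; apply: future_scal; last exact: lift_future.
by rewrite invr_gt0 subr_gt0; apply/diskE.
Qed.

Lemma lor_unit_lift z : disk z -> lor (unit_lift z) (unit_lift z) = -1.
Proof.
move=> /diskE hz; rewrite lor_scal lorC lor_scal lor_lift; field.
by rewrite gt_eqF// subr_gt0.
Qed.

Lemma proj_unit_lift z : disk z -> proj (unit_lift z) = z.
Proof.
move=> hz; rewrite proj_scal ?proj_lift// invr_gt0 subr_gt0; exact/diskE.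
Qed.

Lemma unit_lift_proj u : 0 < u.1.1 -> lor u u = -1 -> unit_lift (proj u) = u.
Proof.
move=> u0 hu; have fu : future u by split=> //; rewrite hu ltrN10.
have r1 : rad u = 1 by rewrite /rad hu opprK sqrtr1.
rewrite /unit_lift lift_proj// proj_norm// r1.
have h : u.1.1 + 1 != 0 by rewrite gt_eqF// addr_gt0.
by case: u u0 hu fu r1 h => -[u0 u1] u2 /= *; rewrite /scal/=; congr (_, _, _); field.
Qed.

Lemma hyp_param a b : 0 < a -> a ^+ 2 = 1 + b ^+ 2 ->
  exists t, a = cosh t /\ b = sinh t.
Proof.
move=> a0 h; have hp : (a + b) * (a - b) = 1 by rewrite mulrC -subr_sqr h; ring.
have p0 : 0 < a + b.
  rewrite ltNge; apply/negP => h0.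
  have h1 : a - b <= 0 by nra.
  nra.
exists (ln (a + b)); rewrite /cosh /sinh expRN lnK ?posrE//.
have -> : (a + b)^-1 = a - b.
  by apply: (@mulfI _ (a + b)); rewrite ?gt_eqF// hp divff// gt_eqF.
split; lra.
Qed.

Lemma hyp_param_ge0 a : 1 <= a -> exists t, 0 <= t /\ a = cosh t.
Proof.
move=> a1; have h : 0 <= a ^+ 2 - 1 by nra.
have [|t [e1 e2]] := @hyp_param a (Num.sqrt (a ^+ 2 - 1)) ltac:(lra).
  by rewrite sqr_sqrtr// addrC subrK.
exists `|t|; split; [exact: normr_ge0|by rewrite cosh_abs].
Qed.

Lemma frame_exists A : 0 < A.1.1 -> lor A A = -1 -> exists B, frame A B.
Proof.
case: A => -[a0 a1] a2 /= h0; rewrite /lor/= => h.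
have n0 : 1 + a0 != 0 by rewrite gt_eqF// addr_gt0.
have h2 : a2 ^+ 2 = (a0 - 1) * (1 + a0) - a1 ^+ 2 by lra.
exists (a1, 1 + a1 ^+ 2 / (1 + a0), a1 * a2 / (1 + a0)); split; [exact: h| | |exact: h0]; rewrite /lor/=.
- have -> : a1 * a2 / (1 + a0) * (a1 * a2 / (1 + a0)) =
    a1 ^+ 2 * a2 ^+ 2 / (1 + a0) ^+ 2 by field.
  by rewrite h2; field.
- have -> : a2 * (a1 * a2 / (1 + a0)) = a1 * a2 ^+ 2 / (1 + a0) by field.
  by rewrite h2; field.
Qed.

(** Two points of the hyperboloid whose product is - cosh l are joined by the
    geodesic of a frame at the first one, in time l. *)
Lemma frame_through A W l : 0 < A.1.1 -> lor A A = -1 -> lor W W = -1 ->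
  0 < l -> - lor A W = cosh l ->
  exists2 B, frame A B & W = comb A B (cosh l) (sinh l) 0 /\
   forall Y, lor Y B = (lor Y W - cosh l * lor Y A) / sinh l.
Proof.
move=> A0 hA hW l0 hAW; have s0 := sinh_gt0 l0; have sn : sinh l != 0 by rewrite gt_eqF.
have hs := cosh_sqr l.
pose B : vec R := ((W.1.1 - cosh l * A.1.1) / sinh l,
  (W.1.2 - cosh l * A.1.2) / sinh l, (W.2 - cosh l * A.2) / sinh l).
have hY Y : lor Y B = (lor Y W - cosh l * lor Y A) / sinh l.
  by rewrite /lor /B/=; field.
have eAW : lor A W = - cosh l by lra.
have hAB : lor A B = 0 by rewrite hY hA eAW; field.
exists B.
  split => //; rewrite hY (lorC B A) hAB (lorC B W) hY hW (lorC W A) eAW mulr0 subr0.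
  have -> : (-1 - cosh l * - cosh l) = cosh l ^+ 2 - 1 by ring.
  by rewrite hs; field.
split=> //.
rewrite /B; clear -sn; case: W => -[w0 w1] w2.
by rewrite /comb /=; congr (_, _, _); field.
Qed.

Lemma lor_unit_liftE z w : disk z -> disk w ->
  1 <= - lor (unit_lift z) (unit_lift w) ?= iff (z == w).
Proof.
move=> /diskE hz /diskE hw.
have z0 : 0 < 1 - (z.1 ^+ 2 + z.2 ^+ 2) by rewrite subr_gt0.
have w0 : 0 < 1 - (w.1 ^+ 2 + w.2 ^+ 2) by rewrite subr_gt0.
have -> : - lor (unit_lift z) (unit_lift w) = 1 +
   2 * ((z.1 - w.1) ^+ 2 + (z.2 - w.2) ^+ 2) /
   ((1 - (z.1 ^+ 2 + z.2 ^+ 2)) * (1 - (w.1 ^+ 2 + w.2 ^+ 2))).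
  by rewrite /lor/=; field; rewrite !gt_eqF.
have d0 : 0 <= (z.1 - w.1) ^+ 2 + (z.2 - w.2) ^+ 2 by rewrite addr_ge0 ?sqr_ge0.
split; first by rewrite lerDl divr_ge0// mulr_ge0// ltW.
rewrite -[X in X == _]addr0 (inj_eq (addrI 1)) eq_sym.
rewrite mulf_eq0 invr_eq0 (mulf_eq0 (1 - _)) (gt_eqF z0) (gt_eqF w0) !orbF mulf_eq0 pnatr_eq0/=.
rewrite paddr_eq0 ?sqr_ge0// !sqrf_eq0 !subr_eq0.
by case: z w {hz hw z0 w0 d0} => ? ? [].
Qed.

Lemma cosh_hyp_dist z w : disk z -> disk w ->
  cosh (hyp_dist z w) = - lor (unit_lift z) (unit_lift w).
Proof.
move=> hz hw; have [z0 _] := unit_lift_future hz.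
have hzz := lor_unit_lift hz; have hww := lor_unit_lift hw.
have [zw|zw] := eqVneq z w.
  have [B F] := frame_exists z0 hzz.
  have e : z = geo (unit_lift z) B 0.
    rewrite -[LHS](proj_unit_lift hz) /geo; congr proj.
    rewrite cosh0 sinh0 /comb !mul1r !mul0r !addr0.
    by case: (unit_lift z) => -[].
  rewrite -zw {1 2}e hyp_dist_geo// subrr normr0 cosh0 hzz; lra.
have [h1 h2] := lor_unit_liftE hz hw.
have [l [l0 hl]] := hyp_param_ge0 h1.
have {}l0 : 0 < l.
  rewrite lt_neqAle l0 andbT; apply/eqP => l00.
  by move: h2; rewrite hl -l00 cosh0 eqxx (negbTE zw).
have [B F [eW _]] := frame_through z0 hzz hww l0 hl.
have e : z = geo (unit_lift z) B 0.
  rewrite -[LHS](proj_unit_lift hz) /geo; congr proj.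
  rewrite cosh0 sinh0 /comb !mul1r !mul0r !addr0.
  by case: (unit_lift z) => -[].
have e' : w = geo (unit_lift z) B l by rewrite -[LHS](proj_unit_lift hw) eW.
by rewrite {1}e {1}e' hyp_dist_geo// sub0r normrN gtr0_norm.
Qed.

(** Rigidity of isometric embeddings: the three products between g t0, g t1 and
    g t are those of points of a hyperbola, which determines the coordinates of g t
    along A and B; then the third coordinate vanishes because g t has square -1. *)
Lemma unit_speed_geodesicE T (g : R -> plane R) t0 t1 :
  unit_speed_geodesic T g -> T t0 -> T t1 -> t0 < t1 ->
  exists2 B, frame (unit_lift (g t0)) B &
    forall t, T t -> g t = geo (unit_lift (g t0)) B (t - t0).
Proof.
move=> [hd hg] T0 T1 t01.
have l0 : 0 < t1 - t0 by rewrite subr_gt0.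
set A := unit_lift (g t0); have [A0 _] := unit_lift_future (hd _ T0).
have hA : lor A A = -1 by exact/lor_unit_lift/hd.
have hW : lor (unit_lift (g t1)) (unit_lift (g t1)) = -1 by exact/lor_unit_lift/hd.
have key s t : T s -> T t -> - lor (unit_lift (g s)) (unit_lift (g t)) = cosh (t - s).
  move=> Ts Tt; rewrite -cosh_hyp_dist ?hg//; try exact: hd.
  by rewrite cosh_abs -coshN opprB.
have [B F [_ hB]] := frame_through A0 hA hW l0 (key _ _ T0 T1).
exists B => // t Tt.
set Y := unit_lift (g t).
have hYA : lor Y A = - cosh (t - t0).
  by rewrite -(key _ _ T0 Tt) opprK lorC.
have hYW : lor Y (unit_lift (g t1)) = - cosh (t - t1).
  by rewrite -(key _ _ T1 Tt) opprK lorC.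
have hYB : lor Y B = sinh (t - t0).
  rewrite hB hYA hYW.
  have -> : t - t1 = (t - t0) + - (t1 - t0) by ring.
  rewrite coshD coshN sinhN; field.
  by rewrite gt_eqF// sinh_gt0.
have eY := comb_complete Y F.
have hYC : lor Y (cross A B) = 0.
  have := lor_comb2 (- lor Y A) (lor Y B) (lor Y (cross A B))
    (- lor Y A) (lor Y B) (lor Y (cross A B)) F.
  rewrite -eY lor_unit_lift; last exact: hd.
  rewrite hYA hYB opprK -!expr2 cosh_sqr => h.
  by apply/eqP; rewrite -sqrf_eq0; apply/eqP; lra.
rewrite -(proj_unit_lift (hd _ Tt)) /geo -/Y {1}eY hYA hYB hYC opprK.
by [].
Qed.

(** A complete geodesic is the trace on the disk of a plane through the origin. *)
Lemma range_geo A B : frame A B ->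
  range (geo A B) = [set z | disk z /\ lor (lift z) (cross A B) = 0].
Proof.
move=> F; apply/seteqP; split=> [_ [t _ <-]|z [hz h]] /=.
  split; first exact: geo_disk.
  rewrite lift_proj; last exact: geo_future.
  by rewrite lor_scal lor_comb lorC crossA lorC crossB !mulr0 mul0r !addr0 mulr0.
set Y := unit_lift z.
have hYC : lor Y (cross A B) = 0 by rewrite /Y lor_scal h mulr0.
have eY := comb_complete Y F.
have fA : future A by case: F => hA _ _ A0; split=> //; rewrite hA ltrN10.
have a0 : 0 < - lor Y A by rewrite oppr_gt0; apply: lor_lt0 => //; exact: unit_lift_future.
have hh : (- lor Y A) ^+ 2 = 1 + lor Y B ^+ 2.
  have := lor_comb2 (- lor Y A) (lor Y B) (lor Y (cross A B))
    (- lor Y A) (lor Y B) (lor Y (cross A B)) F.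
  by rewrite -eY lor_unit_lift// hYC => h1; lra.
have [t [e1 e2]] := hyp_param a0 hh.
exists t => //; rewrite /geo -e1 -e2 -[RHS](proj_unit_lift hz) -/Y [in RHS]eY.
by rewrite hYC.
Qed.

Lemma complete_geodesicE L z : complete_geodesic L -> L z ->
  exists2 B, frame (unit_lift z) B & L = range (geo (unit_lift z) B).
Proof.
move=> [g [hg ->]] [t0 _ <-].
have t01 : t0 < t0 + 1 by rewrite ltrDl.
have [B F h] := unit_speed_geodesicE hg I I t01.
exists B => //; apply/seteqP; split=> [_ [t _ <-]|_ [t _ <-]].
  by exists (t - t0) => //; rewrite -h.
by exists (t + t0) => //; rewrite h// addrK.
Qed.

End rigidity.

(** * The projective chart of a frame *)

Section chart.
Context {R : realType}.
Implicit Types (a b c d s t x y X : R) (z w : plane R) (u v A B p : vec R).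

(** The Klein model centred at A: the unit disk x^2 + y^2 < 1 is mapped onto the
    disk, chords are mapped onto geodesics and the axis y = 0 onto the geodesic of
    the frame. *)
Definition chart A B x y : plane R := proj (comb A B 1 x y).

Lemma chart_future A B x y : frame A B -> x ^+ 2 + y ^+ 2 < 1 ->
  future (comb A B 1 x y).
Proof. by move=> F h; apply: comb_future => //; rewrite expr1n. Qed.

Lemma chart_disk A B x y : frame A B -> x ^+ 2 + y ^+ 2 < 1 ->
  disk (chart A B x y).
Proof. by move=> F h; exact/proj_disk/chart_future. Qed.

Lemma lor_comb_cross A B a b c : frame A B ->
  lor (comb A B a b c) (cross A B) = c.
Proof.
move=> F; rewrite lor_comb lorC crossA lorC crossB frame_cross//; ring.
Qed.

Lemma chart_range A B A' B' x y : frame A B -> frame A' B' ->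
  x ^+ 2 + y ^+ 2 < 1 ->
  range (geo A' B') (chart A B x y) <->
  lor A (cross A' B') + lor B (cross A' B') * x +
    lor (cross A B) (cross A' B') * y = 0.
Proof.
move=> F F' h; rewrite range_geo//= /chart lift_proj; last exact: chart_future.
have fu := chart_future F h; have r0 := rad_gt0 fu; have [u0 _] := fu.
set e := 2 / _; have e0 : e != 0 by rewrite gt_eqF// divr_gt0// addr_gt0.
rewrite lor_scal lor_comb mul1r (mulrC x) (mulrC y).
split=> [[_ /eqP]|->]; first by rewrite mulf_eq0 (negbTE e0)/= => /eqP.
by rewrite mulr0; split=> //; exact: chart_disk.
Qed.

Lemma chart_axis A B x y : frame A B -> x ^+ 2 + y ^+ 2 < 1 ->
  range (geo A B) (chart A B x y) <-> y = 0.
Proof.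
move=> F h; rewrite chart_range// lorC crossA lorC crossB frame_cross//.
by rewrite mul0r !add0r mul1r.
Qed.

(** The coefficients come from a unit normal vector of square 1; the relation
    between them says that the line meets the unit disk. *)
Lemma chart_line A B L : frame A B -> complete_geodesic L ->
  exists n0 n1 n2, n1 ^+ 2 + n2 ^+ 2 = 1 + n0 ^+ 2 /\
   forall x y, x ^+ 2 + y ^+ 2 < 1 ->
     (L (chart A B x y) <-> n0 + n1 * x + n2 * y = 0).
Proof.
move=> F hL.
have [z Lz] : exists z, L z by have [g [_ ->]] := hL; exists (g 0), 0.
have [B' F' eL] := complete_geodesicE hL Lz.
move: (unit_lift z) F' eL => A' F' ->.
exists (lor A (cross A' B')), (lor B (cross A' B')), (lor (cross A B) (cross A' B')).
split; last by move=> x y h; exact: chart_range.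
set N := cross A' B'; have := frame_cross F'; rewrite -/N => hN.
have := lor_comb2 (- lor N A) (lor N B) (lor N (cross A B))
  (- lor N A) (lor N B) (lor N (cross A B)) F.
rewrite -(comb_complete N F) hN !(lorC N) => h; lra.
Qed.

Lemma scal_comb A B e a b c :
  scal e (comb A B a b c) = comb A B (e * a) (e * b) (e * c).
Proof. rewrite /scal /comb; congr (_, _, _) => /=; ring. Qed.

Definition tanh t : R := sinh t / cosh t.

Lemma tanh_lt s t : (tanh s < tanh t) = (s < t).
Proof.
suff h a b : a < b -> tanh a < tanh b.
  apply/idP/idP; last exact: h.
  by apply: contraTT; rewrite -!leNgt le_eqVlt => /predU1P[->//|/h/ltW].
move=> ab; rewrite /tanh ltr_pdivrMr ?cosh_gt0// mulrAC ltr_pdivlMr ?cosh_gt0//.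
have : 0 < sinh (b - a) by apply: sinh_gt0; rewrite subr_gt0.
rewrite sinhD coshN sinhN; lra.
Qed.

Lemma tanh_le s t : (tanh s <= tanh t) = (s <= t).
Proof. by rewrite !leNgt tanh_lt. Qed.

Lemma tanhN t : tanh (- t) = - tanh t.
Proof. by rewrite /tanh sinhN coshN mulNr. Qed.

Lemma tanh0 : tanh 0 = 0.
Proof. by rewrite /tanh sinh0 mul0r. Qed.

Lemma tanh_sqr_lt1 t : tanh t ^+ 2 < 1.
Proof.
rewrite /tanh expr_div_n ltr_pdivrMr ?exprn_gt0 ?cosh_gt0// mul1r cosh_sqr.
by rewrite ltrDr.
Qed.

Lemma tanh_surj (v : R) : v ^+ 2 < 1 -> exists t, tanh t = v.
Proof.
move=> h; have h0 : 0 < 1 - v ^+ 2 by rewrite subr_gt0.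
set q := Num.sqrt (1 - v ^+ 2); have q0 : 0 < q by rewrite sqrtr_gt0.
have q2 : q ^+ 2 = 1 - v ^+ 2 by rewrite sqr_sqrtr// ltW.
have [||t [e1 e2]] := @hyp_param _ q^-1 (v / q); first by rewrite invr_gt0.
  by rewrite expr_div_n exprVn q2; field; rewrite gt_eqF.
by exists t; rewrite /tanh -e1 -e2; field; rewrite gt_eqF.
Qed.

Lemma tanh_le2 t : 0 <= t -> tanh t <= 2 * t.
Proof.
move=> t0; rewrite /tanh ler_pdivrMr ?cosh_gt0//.
have h1 : 1 - 2 * t <= expR (- t) * expR (- t).
  by rewrite -expRD; have := expR_ge1Dx (- t - t); lra.
have h2 := expR_mulN t; have h3 := expR_gt0 t; have h4 := expR_gt0 (- t).
have h5 : expR t * (1 - 2 * t) <= expR (- t).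
  have : expR t * (1 - 2 * t) <= expR t * (expR (- t) * expR (- t)).
    by rewrite ler_pM2l.
  by rewrite mulrA h2 mul1r.
rewrite /sinh /cosh; nra.
Qed.

Lemma tanh_half : 1 / 20 <= tanh (1 / 2).
Proof.
rewrite /tanh ler_pdivlMr ?cosh_gt0// /sinh /cosh.
have h1 := expR_ge1Dx (1 / 2 : R).
have h2 := expR_mulN (1 / 2 : R); have h3 := expR_gt0 (- (1 / 2) : R).
nra.
Qed.

Lemma frame_dir A B c d : frame A B -> c ^+ 2 + d ^+ 2 = 1 ->
  frame A (comb A B 0 c d).
Proof.
move=> F h; have [hA hB hAB A0] := F; split=> //.
- by rewrite lor_comb2// -!expr2 expr0n subr0.
- by rewrite lorC lor_comb hA (lorC B) hAB crossA; ring.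
Qed.

Lemma comb_comb A B c d a b :
  comb A (comb A B 0 c d) a b 0 = comb A B a (b * c) (b * d).
Proof. rewrite /comb; congr (_, _, _) => /=; ring. Qed.

Lemma geo_dir A B c d t : frame A B ->
  geo A (comb A B 0 c d) t = chart A B (c * tanh t) (d * tanh t).
Proof.
move=> F; rewrite /geo /chart comb_comb -[in RHS](proj_scal _ (cosh_gt0 t)).
rewrite scal_comb mulr1 /tanh; congr (proj (comb _ _ _ _ _));
  by field; rewrite gt_eqF// cosh_gt0.
Qed.

(** The frame at the point (X, 0) of the chart, orthogonal to the axis: its
    geodesic is the vertical chord through (X, 0). *)
Lemma frame_vert A B X q : frame A B -> 0 < q -> q ^+ 2 = 1 - X ^+ 2 ->
  frame (comb A B q^-1 (X / q) 0) (cross A B).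
Proof.
move=> F q0 hq; have qn : q != 0 by rewrite gt_eqF.
have h : (X / q) ^+ 2 + 0 ^+ 2 < q^-1 ^+ 2.
  rewrite expr0n addr0 exprMn -[ltRHS]mul1r ltr_pM2r ?exprn_gt0 ?invr_gt0//.
  by rewrite -subr_gt0 -hq exprn_gt0.
split.
- rewrite lor_comb2//.
  have -> : X / q * (X / q) + 0 * 0 - q^-1 / q = (X ^+ 2 - 1) / q ^+ 2 by field.
  have -> : X ^+ 2 - 1 = - q ^+ 2 by lra.
  by field.
- exact: frame_cross.
- exact: lor_comb_cross.
- by have [] := comb_future F _ h; rewrite // invr_gt0.
Qed.

Lemma geo_vert A B X q t : frame A B -> 0 < q -> q ^+ 2 = 1 - X ^+ 2 ->
  geo (comb A B q^-1 (X / q) 0) (cross A B) t = chart A B X (q * tanh t).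
Proof.
move=> F q0 hq; have F' := frame_vert F q0 hq.
have c0 : 0 < cosh t / q by rewrite divr_gt0// cosh_gt0.
rewrite /chart -[in RHS](proj_scal _ c0) scal_comb; congr proj.
have ht : cosh t / q * (q * tanh t) = sinh t.
  by rewrite /tanh; field; rewrite !gt_eqF// cosh_gt0.
rewrite mulr1 ht /comb !mul0r !addr0; move: (cross A B) => C.
by congr (_, _, _) => /=; field; rewrite gt_eqF.
Qed.
End chart.

Section chart_topology.
Context {R : realType}.
Implicit Types (a b c d s t x y X : R) (z w : plane R) (u v A B p : vec R).

Lemma proj_continuous (T : topologicalType) (f0 f1 f2 : T -> R) (p : T) :
  {for p, continuous f0} -> {for p, continuous f1} -> {for p, continuous f2} ->
  future (f0 p, f1 p, f2 p) ->
  {for p, continuous (fun q => proj (f0 q, f1 q, f2 q))}.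
Proof.
move=> c0 c1 c2 fu.
have r0 := rad_gt0 fu; have u0 : 0 < f0 p by case: fu.
have cr : (fun q => rad (f0 q, f1 q, f2 q)) q @[q --> p] --> rad (f0 p, f1 p, f2 p).
  have -> : (fun q => rad (f0 q, f1 q, f2 q)) =
    (fun q => Num.sqrt (- (f1 q * f1 q + f2 q * f2 q - f0 q * f0 q))) by [].
  apply: (@continuous_comp _ _ _ (fun q => - (f1 q * f1 q + f2 q * f2 q - f0 q * f0 q)) Num.sqrt);
    last exact: sqrt_continuous.
  by apply: cvgN; apply: cvgB; [apply: cvgD; exact: cvgM|exact: cvgM].
have ci : (f0 q + rad (f0 q, f1 q, f2 q))^-1 @[q --> p] -->
    (f0 p + rad (f0 p, f1 p, f2 p))^-1.
  by apply: cvgV; [rewrite gt_eqF// addr_gt0|exact: cvgD].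
by apply: (@cvg_pair _ _ _ _ (nbhs (f1 p / (f0 p + rad (f0 p, f1 p, f2 p))))
  (nbhs (f2 p / (f0 p + rad (f0 p, f1 p, f2 p))))); apply: cvgM.
Qed.

Lemma chart_continuous (T : topologicalType) A B (f g : T -> R) (p : T) :
  frame A B -> {for p, continuous f} -> {for p, continuous g} ->
  f p ^+ 2 + g p ^+ 2 < 1 ->
  {for p, continuous (fun q => chart A B (f q) (g q))}.
Proof.
move=> F cf cg h.
have lin a b c : {for p, continuous (fun q => 1 * a + f q * b + g q * c)}.
  apply: cvgD; first apply: cvgD; first exact: cvg_cst.
    by apply: cvgM => //; exact: cvg_cst.
  by apply: cvgM => //; exact: cvg_cst.
exact: (proj_continuous (lin _ _ _) (lin _ _ _) (lin _ _ _) (chart_future F h)).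
Qed.

Lemma enorm_sub_circle z : disk z -> exists2 w, circle w & enorm (z - w) <=
  1 - (z.1 ^+ 2 + z.2 ^+ 2).
Proof.
move=> /diskE; set n := _ + _ => n1.
have n0 : 0 <= n by rewrite addr_ge0 ?sqr_ge0.
have [e|ne] := eqVneq n 0.
  have z0 : z = (0, 0).
    move/eqP: e; rewrite /n paddr_eq0 ?sqr_ge0// !sqrf_eq0.
    by case: z {n n1 n0} => ? ? /= /andP[/eqP -> /eqP ->].
  exists (1, 0); first by rewrite /circle/= /enorm/= expr1n expr0n addr0 sqrtr1.
  by rewrite e subr0 z0 /enorm/= !sub0r oppr0 sqrrN expr1n expr0n addr0 sqrtr1.
have {}n0 : 0 < n by rewrite lt_neqAle eq_sym ne.
set r := Num.sqrt n; have r0 : 0 < r by rewrite sqrtr_gt0.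
have r2 : r ^+ 2 = n by rewrite sqr_sqrtr// ltW.
have r1 : r < 1 by nra.
exists (z.1 / r, z.2 / r).
  rewrite /circle/= /enorm/= !expr_div_n -mulrDl -/n r2 divff ?sqrtr1//.
rewrite /enorm/= (_ : _ + _ = (1 - r) ^+ 2); last first.
  transitivity (n * (1 - r^-1) ^+ 2); first by rewrite /n; ring.
  by rewrite -r2; field; rewrite gt_eqF.
rewrite sqrtr_sqr gtr0_norm ?subr_gt0// -r2; nra.
Qed.

Lemma delta_le (I : set (plane R)) z : I z -> disk z ->
  delta I <= 1 - (z.1 ^+ 2 + z.2 ^+ 2).
Proof.
move=> Iz /enorm_sub_circle[w hw h]; apply: le_trans h.
apply: ge_inf; last by exists z, w.
by exists 0 => _ [? [? [_ _ ->]]]; exact: sqrtr_ge0.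
Qed.

Lemma frame_end_gt0 A B : frame A B -> 0 < A.1.1 + B.1.1.
Proof.
move=> F; have ht := frame_time F; have [_ _ _ A0] := F.
have h : B.1.1 ^+ 2 < A.1.1 ^+ 2 by have := sqr_ge0 (cross A B).1.1; lra.
nra.
Qed.

(** As the point (X, 0) tends to the end of the axis, the Euclidean depth of its
    image is at most of the order of sqrt (1 - X^2): the lift A + XB tends to a
    null vector, with positive time coordinate. *)
Lemma delta_chart A B : frame A B -> exists2 M, 0 < M &
  forall (I : set (plane R)) X q, 0 <= X -> 0 < q -> q ^+ 2 = 1 - X ^+ 2 ->
    I (chart A B X 0) -> delta I <= M * q.
Proof.
move=> F; have e0 := frame_end_gt0 F; have [_ _ _ A0] := F.
pose m := Num.min A.1.1 (A.1.1 + B.1.1).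
have m0 : 0 < m by rewrite lt_min A0.
exists (2 / m) => [|I X q X0 q0 hq IX]; first by rewrite divr_gt0.
have X1 : X <= 1 by have := sqr_ge0 q; nra.
have hX : X ^+ 2 + 0 ^+ 2 < 1.
  by rewrite expr0n addr0 -subr_gt0 -hq exprn_gt0.
apply: le_trans (delta_le IX (chart_disk F hX)) _.
have fu := chart_future F hX.
rewrite proj_norm//.
have -> : rad (comb A B 1 X 0) = q.
  rewrite /rad lor_comb2//.
  have -> : - (X * X + 0 * 0 - 1 * 1) = q ^+ 2 by rewrite hq; ring.
  by rewrite sqrtr_sqr gtr0_norm.
have hm : m <= (comb A B 1 X 0).1.1.
  have h1 : m <= A.1.1 by rewrite ge_min lexx.
  have h2 : m <= A.1.1 + B.1.1 by rewrite ge_min lexx orbT.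
  rewrite /comb/= mul0r addr0 mul1r; nra.
rewrite (mulrAC 2 _ q) ler_pM2l ?mulr_gt0// lef_pV2 ?posrE//; last by rewrite addr_gt0// (lt_le_trans m0).
by rewrite (le_trans hm)// lerDl ltW.
Qed.

End chart_topology.

(** * Extending the slopes of the leaves to the gaps *)

Section slopes.
Context {R : realType}.

(** The greatest C-Lipschitz nondecreasing extension is
    inf_k (f k + C max (0, x - k)); it is truncated at sup f so that the extension
    takes no value outside the convex hull of the values of f. *)
Lemma monotone_lipschitz_extension (K : set R) (f : R -> R) (C : R) (lo hi : R) :
  0 <= C -> K !=set0 -> (forall k, K k -> lo <= f k <= hi) ->
  (forall k l, K k -> K l -> k <= l -> 0 <= f l - f k <= C * (l - k)) ->
  exists F : R -> R, [/\ forall k, K k -> F k = f k,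
    forall x y, x <= y -> 0 <= F y - F x <= C * (y - x),
    forall x y, (forall k, K k -> f k <= y) -> F x <= y &
    forall x y, (forall k, K k -> y <= f k) -> y <= F x].
Proof.
move=> C0 [k0 Kk0] fb hf.
pose S x := [set f k + C * Num.max 0 (x - k) | k in K].
have S0 x : S x !=set0 by exists (f k0 + C * Num.max 0 (x - k0)), k0.
have max0 (r : R) : 0 <= Num.max 0 r by rewrite le_max lexx.
have Slb x : has_lbound (S x).
  exists lo => _ [k Kk <-]; have /andP[h _] := fb k Kk.
  by apply: le_trans h _; rewrite lerDl mulr_ge0.
pose h := sup (f @` K).
have hK : has_sup (f @` K).
  split; first by exists (f k0), k0.
  by exists hi => _ [k Kk <-]; have /andP[] := fb k Kk.
have fh k : K k -> f k <= h by move=> Kk; apply: ub_le_sup; [exact: hK.2|exists k].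
pose G x := inf (S x).
have GE k : K k -> G k = f k.
  move=> Kk; apply/eqP; rewrite eq_le; apply/andP; split.
    apply: ge_inf; first exact: Slb.
    by exists k => //; rewrite subrr maxxx mulr0 addr0.
  apply: lb_le_inf; first exact: S0.
  move=> _ [l Kl <-]; have [kl|lk] := leP k l.
    have /andP[h1 _] := hf _ _ Kk Kl kl.
    by apply: (@le_trans _ _ (f l)); [rewrite -subr_ge0|rewrite lerDl mulr_ge0].
  have /andP[_ h1] := hf _ _ Kl Kk (ltW lk).
  rewrite -lerBlDl; apply: le_trans h1 _; apply: ler_wpM2l => //.
  by rewrite le_max lexx orbT.
have Gmono x y : x <= y -> G x <= G y.
  move=> xy; apply: lb_le_inf; first exact: S0.
  move=> _ [k Kk <-]; apply: (@le_trans _ _ (f k + C * Num.max 0 (x - k))).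
    by apply: ge_inf; [exact: Slb|exists k].
  rewrite lerD2l ler_wpM2l// ge_max max0/= le_max; apply/orP; right.
  by rewrite lerB.
have Glip x y : x <= y -> G y - C * (y - x) <= G x.
  move=> xy; apply: lb_le_inf; first exact: S0.
  move=> _ [k Kk <-]; rewrite lerBlDr.
  apply: (@le_trans _ _ (f k + C * Num.max 0 (y - k))).
    by apply: ge_inf; [exact: Slb|exists k].
  rewrite -addrA lerD2l -mulrDr ler_wpM2l// ge_max; apply/andP; split.
    by rewrite addr_ge0 ?subr_ge0.
  have : x - k <= Num.max 0 (x - k) by rewrite le_max lexx orbT.
  lra.
exists (fun x => Num.min (G x) h); split.
- by move=> k Kk; rewrite GE// min_l// fh.
- move=> x y xy; have h1 := Gmono _ _ xy; have h2 := Glip _ _ xy.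
  have h3 : 0 <= C * (y - x) by rewrite mulr_ge0// subr_ge0.
  by case: (leP (G x) h) => ?; case: (leP (G y) h) => ?; apply/andP; split; lra.
- move=> x y hy; rewrite ge_min; apply/orP; right.
  by apply: ge_sup => [|_ [k Kk <-]]; [exists (f k0), k0|exact: hy].
- move=> x y hy; rewrite le_min; apply/andP; split.
    apply: lb_le_inf; first exact: S0.
    move=> _ [k Kk <-]; apply: le_trans (hy k Kk) _.
    by rewrite lerDl mulr_ge0.
  exact: le_trans (hy k0 Kk0) (fh k0 Kk0).
Qed.

End slopes.

Section planar.
Context {R : realType}.

Lemma affine_pos (w p q x : R) : 0 < p -> `|x| <= w ->
  (forall y, `|y| <= w -> p + q * y != 0) -> 0 < p + q * x.
Proof.
move=> p0 xX hn; rewrite ltNge; apply/negP => hle.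
have qx : q * x < 0 by lra.
have q0 : q != 0 by apply: contraTneq qx => ->; rewrite mul0r ltxx.
suff h : `|- p / q| <= w by have /negP := hn _ h; apply; apply/eqP; field.
have : `|p| <= `|q| * `|x|.
  by rewrite -normrM (gtr0_norm p0) (ltr0_norm qx); lra.
move=> h1; rewrite normrM normrN normfV ler_pdivrMr ?normr_gt0//.
by rewrite mulrC; apply: le_trans h1 _; rewrite ler_wpM2l.
Qed.

(** The strip of half-width 2h around the axis is inside the unit disk up to an
    abscissa X' which exceeds X; the margin makes the order of the extended lines
    strict at X. *)
Lemma window_exists (h X : R) :
  0 < h -> h <= 1 / 100 -> 0 < X -> X ^+ 2 = 1 - 100 * h ^+ 2 ->
  exists X', [/\ X < X', 1 / 2 <= X' & forall k m x, `|k| <= h -> `|m| <= `|k| ->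
    `|x| <= X' -> x ^+ 2 + (k + m * x) ^+ 2 < 1].
Proof.
move=> h0 hh hX0 hX.
have h2_gt0 : 0 < h ^+ 2 by rewrite exprn_gt0.
have h2_le : h ^+ 2 <= 1 / 10000.
  have -> : 1 / 10000 = (1 / 100) ^+ 2 :> R by rewrite expr_div_n expr1n -natrX.
  by rewrite ler_sqr// ?nnegrE ?ltW.
pose X' := Num.sqrt (1 - 25 * h ^+ 2).
have hX'0 : 0 < X' by rewrite sqrtr_gt0; lra.
have hX' : X' ^+ 2 = 1 - 25 * h ^+ 2 by rewrite sqr_sqrtr//; lra.
move: X' hX'0 hX' => X' hX'0 hX'.
have XX' : X < X' by rewrite -ltr_sqr ?nnegrE ?ltW// hX hX'; lra.
have X'half : 1 / 2 <= X'.
  by rewrite -ler_sqr ?nnegrE//; [rewrite hX' expr_div_n; lra|exact: ltW].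
have X'1 : X' < 1 by rewrite -ltr_sqr ?nnegrE ?ltW// hX'; lra.
exists X'; split=> // k m x.
move=> kh mk xX.
have h1 : `|k + m * x| <= 2 * h.
  apply: le_trans (ler_normD _ _) _; rewrite normrM.
  have : `|m| * `|x| <= h * 1.
    by apply: ler_pM => //; [exact: le_trans mk kh|exact: le_trans xX (ltW X'1)].
  lra.
have h2 : (k + m * x) ^+ 2 <= (2 * h) ^+ 2.
  by rewrite -(real_normK (num_real (k + m * x))) ler_sqr ?nnegrE// mulr_ge0// ltW.
have h3 : x ^+ 2 <= X' ^+ 2.
  by rewrite -(real_normK (num_real x)) ler_sqr ?nnegrE// ltW.
have h4 : 0 < h ^+ 2 by rewrite exprn_gt0.
move: h2 h3; rewrite hX' exprMn; lra.
Qed.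

(** Disjoint lines keep their order as long as one of them is inside the disk. *)
Lemma line_order (line : R -> R -> Prop) (h w : R) :
  (forall b m b' m' x, line b m -> `|b| <= h -> line b' m' ->
    x ^+ 2 + (b + m * x) ^+ 2 < 1 -> b + m * x = b' + m' * x -> b = b' /\ m = m') ->
  (forall k m x, line k m -> `|k| <= h -> `|x| <= w -> x ^+ 2 + (k + m * x) ^+ 2 < 1) ->
  forall k m b m' x, line k m -> `|k| <= h -> line b m' -> `|x| <= w ->
    (k < b -> k + m * x < b + m' * x) /\ (b < k -> b + m' * x < k + m * x).
Proof.
move=> line_cross in_disk k m b m' x.
move=> lk kh lb xX.
have hne : b != k -> forall y, `|y| <= w -> b + m' * y != k + m * y.
  move=> bk y yX; apply: contra bk => /eqP e.
  have [|->//] := line_cross _ _ _ _ _ lk kh lb _ (esym e).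
  exact: (in_disk _ _ _ lk).
split=> bk.
- have := @affine_pos w (b - k) (m' - m) x; rewrite subr_gt0 => /(_ bk xX).
  suff hy : forall y, `|y| <= w -> b - k + (m' - m) * y != 0 by move=> /(_ hy); lra.
  move=> y yX; have := hne _ y yX; rewrite gt_eqF// => /(_ isT); apply: contra.
  by move=> /eqP e; apply/eqP; lra.
- have := @affine_pos w (k - b) (m - m') x; rewrite subr_gt0 => /(_ bk xX).
  suff hy : forall y, `|y| <= w -> k - b + (m - m') * y != 0 by move=> /(_ hy); lra.
  move=> y yX; have := hne _ y yX; rewrite lt_eqF// => /(_ isT); apply: contra.
  by move=> /eqP e; apply/eqP; lra.
Qed.

(** A relation [line b m] says that y = b + mx is a leaf. Leaves with intercept in
    [-h, h] do not cross for -1/2 <= x <= X', hence m + b / X' is nondecreasing and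
    4-Lipschitz in b, and so is its extension to all b. The lines with the extended
    slopes foliate the strip, and no other leaf meets them for |b| <= h / 10: a leaf
    with intercept in [-h, h] is itself one of these lines, and a leaf with a larger
    intercept stays beyond them all at X', thus on the whole of [0, X'], because the
    extension of m + b / X' does not exceed the largest value on the leaves. To the
    left of 0 the crude bounds on the slopes are enough. *)
Lemma slope_extension (line : R -> R -> Prop) (h X : R) :
  line 0 0 ->
  (forall b m, line b m -> `|m| <= `|b|) ->
  (forall b m b' m' x, line b m -> `|b| <= h -> line b' m' ->
    x ^+ 2 + (b + m * x) ^+ 2 < 1 -> b + m * x = b' + m' * x -> b = b' /\ m = m') ->
  0 < h -> h <= 1 / 100 -> 0 < X -> X ^+ 2 = 1 - 100 * h ^+ 2 ->
  exists mh : R -> R, [/\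
    forall b m, line b m -> `|b| <= h -> mh b = m,
    forall b c, `|mh b - mh c| <= 4 * `|b - c|,
    forall b c x, - (1 / 100) <= x -> x <= X -> b < c -> b + mh b * x < c + mh c * x &
    forall b x b' m', `|b| <= h / 10 -> - (1 / 100) <= x -> x <= X -> line b' m' ->
      b + mh b * x = b' + m' * x -> b' = b /\ mh b = m'].
Proof.
move=> line0 line_slope line_cross h0 hh hX0 hX.
have [X' [XX' X'half in_disk]] := window_exists h0 hh hX0 hX.
have hX'0 : 0 < X' by apply: lt_le_trans X'half.
have order := line_order line_cross
  (fun k m x (l : line k m) kh => in_disk k m x kh (line_slope _ _ l)).
clear hX.
pose K := [set k | `|k| <= h /\ exists m, line k m].
pose m_ k := xget 0 [set m | line k m].
have lineK k : K k -> line k (m_ k).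
  by move=> [_ [m lm]]; apply: (xgetPex 0); exists m.
have X'n : X' != 0 by rewrite gt_eqF.
(* X' times f k is the height of the leaf at X' *)
pose f k := m_ k + k / X'.
have iX' : X'^-1 <= 2 by rewrite invf_ple ?posrE//; lra.
have iX0 : 0 < X'^-1 by rewrite invr_gt0.
have uniq b m m' : line b m -> line b m' -> `|b| <= h -> m = m'.
  move=> l1 l2 bh; have [||//] := line_cross b m b m' 0 l1 bh l2; last by rewrite !mulr0.
  by apply: in_disk => //; [exact: line_slope|rewrite normr0 ltW].
have mK k m : line k m -> `|k| <= h -> m_ k = m.
  move=> lm kh; apply: (uniq _ _ _ _ lm kh); apply: lineK; split=> //; by exists m.
have K0 : K 0 by split; [rewrite normr0 ltW|exists 0].
have nX' : `|X'| <= X' by rewrite gtr0_norm.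
have nhalf : `|- (1 / 2)| <= X' by rewrite normrN gtr0_norm//; lra.
have fdiff k l : K k -> K l -> k <= l -> 0 <= f l - f k <= 4 * (l - k).
  move=> Kk Kl; rewrite le_eqVlt => /predU1P[->|kl].
    by rewrite !subrr mulr0 lexx.
  have [h1 _] := order _ _ _ _ _ (lineK _ Kk) Kk.1 (lineK _ Kl) nX'.
  have [h2 _] := order _ _ _ _ _ (lineK _ Kk) Kk.1 (lineK _ Kl) nhalf.
  have {}h1 := h1 kl; have {}h2 := h2 kl.
  have e : f l - f k = (l + m_ l * X' - (k + m_ k * X')) / X'.
    by rewrite /f; field.
  apply/andP; split; first by rewrite e divr_ge0 ?ltW// subr_gt0.
  have : (l - k) / X' <= (l - k) * 2 by rewrite ler_pM2l ?subr_gt0.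
  rewrite /f => h3; lra.
have fb k : K k -> - (3 * h) <= f k <= 3 * h.
  move=> Kk; rewrite -ler_norml; apply: le_trans (ler_normD _ _) _.
  have h1 := line_slope _ _ (lineK _ Kk).
  have h2 : `|k / X'| <= h * 2.
    by rewrite normrM (gtr0_norm iX0); apply: ler_pM => //; [exact: ltW|exact: Kk.1].
  have := Kk.1; lra.
have [F [FK Flip Fub Flb]] :=
  monotone_lipschitz_extension (ler0n R 4) (ex_intro _ 0 K0 : K !=set0) fb fdiff.
pose mh b := F b - b / X'.
have mhK b m : line b m -> `|b| <= h -> mh b = m.
  move=> lb bh; have Kb : K b by split=> //; exists m.
  by rewrite /mh FK// /f (mK _ _ lb bh) addrK.
have lip b c : b <= c -> - (2 * (c - b)) <= mh c - mh b <= 4 * (c - b).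
  move=> bc; have /andP[h1 h2] := Flip _ _ bc.
  have h3 : 0 <= (c - b) / X' by rewrite divr_ge0 ?subr_ge0// ltW.
  have : (c - b) / X' <= (c - b) * 2 by apply: ler_wpM2l; rewrite ?subr_ge0.
  rewrite /mh => h4; apply/andP; split; lra.
have lipn b c : `|mh b - mh c| <= 4 * `|b - c|.
  wlog bc : b c / b <= c => [hw|].
    by have [/hw//|/ltW/hw] := leP b c; rewrite (distrC (mh c)) (distrC c).
  rewrite distrC (distrC b) (ger0_norm (_ : 0 <= c - b)) ?subr_ge0//.
  have /andP[h1 h2] := lip _ _ bc; rewrite ler_norml; apply/andP; split; lra.
have mono b c x : - (1 / 100) <= x -> x <= X -> b < c -> b + mh b * x < c + mh c * x.
  move=> x1 xX bc; have /andP[h1 h2] := lip _ _ (ltW bc).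
  have [x0|x0] := leP 0 x; last by nra.
  have /andP[h3 _] := Flip _ _ (ltW bc).
  have e z : z + mh z * x = z * (1 - x / X') + F z * x.
    by rewrite /mh; field.
  rewrite !e; apply: ltr_leD; last by rewrite ler_wpM2r// -subr_ge0.
  by rewrite ltr_pM2r// subr_gt0 ltr_pdivrMr// mul1r (le_lt_trans xX).
have mh0 : mh 0 = 0 by apply: mhK => //; rewrite normr0 ltW.
exists mh; split=> // b x b' m' bh x1 xX lb' e.
have mhb : `|mh b| <= 4 * `|b| by have := lipn b 0; rewrite mh0 !subr0.
have hs := line_slope _ _ lb'.
have [hb'|hb'] := leP `|b'| h.
  have hm := mhK _ _ lb' hb'; rewrite -hm in e.
  case: (ltgtP b b') => [/(mono _ _ _ x1 xX)|/(mono _ _ _ x1 xX)|->//].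
    by rewrite e ltxx.
  by rewrite e ltxx.
(* now |b'| > h >= 10 |b|: to the left of 0 the heights at x are apart *)
exfalso; have [x0|x0] := ltP x 0.
  have nx : `|x| <= 1 / 100 by rewrite ltr0_norm//; lra.
  have hle c : `|c * x| <= `|c| / 100.
    by rewrite normrM; have := ler_wpM2l (normr_ge0 c) nx; lra.
  have h1 := ler_normD b (mh b * x).
  have h2 : `|b'| <= `|b' + m' * x| + `|m' * x|.
    by rewrite -{1}(addrK (m' * x) b'); exact: ler_normB.
  rewrite e in h1; have h3 := hle (mh b); have h4 := hle m'; lra.
have e1 z : z + mh z * x = z * (1 - x / X') + F z * x by rewrite /mh; field.
have e2 : b' + m' * x = b' * (1 - x / X') + (m' + b' / X') * x by field.
(* heights at x are averages of heights at 0 and at X' *)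
rewrite e1 e2 in e.
have hx : 0 < 1 - x / X' by rewrite subr_gt0 ltr_pdivrMr// mul1r (le_lt_trans xX).
have e3 k : m' + b' / X' - f k = (b' + m' * X' - (k + m_ k * X')) / X'.
  by rewrite /f; field.
have := bh; rewrite ler_norml => /andP[bh1 bh2].
have [b'0|b'0] := ltP 0 b'.
- have hF : F b <= m' + b' / X'.
    apply: Fub => k Kk; have [+ _] := order _ _ _ _ _ (lineK _ Kk) Kk.1 lb' nX'.
    have kb : k < b' by apply: le_lt_trans (le_trans (ler_norm k) Kk.1) _; rewrite -(gtr0_norm b'0).
    move=> /(_ kb) hk; rewrite -subr_ge0 e3.
    by rewrite divr_ge0 ?(ltW hX'0)// subr_ge0 ltW.
  have : b * (1 - x / X') + F b * x < b' * (1 - x / X') + (m' + b' / X') * x.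
    apply: ltr_leD; last by rewrite ler_wpM2r.
    by rewrite ltr_pM2r//; rewrite (gtr0_norm b'0) in hb'; lra.
  by rewrite e ltxx.
- have hF : m' + b' / X' <= F b.
    apply: Flb => k Kk; have [_ +] := order _ _ _ _ _ (lineK _ Kk) Kk.1 lb' nX'.
    have kb : b' < k.
      have := Kk.1; rewrite ler_norml => /andP[+ _]; apply: lt_le_trans.
      by rewrite ltrNr -(ler0_norm b'0).
    move=> /(_ kb) hk; rewrite -subr_le0 e3.
    by rewrite pmulr_lle0 ?invr_gt0// subr_le0 ltW.
  have : b' * (1 - x / X') + (m' + b' / X') * x < b * (1 - x / X') + F b * x.
    apply: ltr_leD; last by rewrite ler_wpM2r.
    by rewrite ltr_pM2r//; rewrite (ler0_norm b'0) in hb'; lra.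
  by rewrite e ltxx.
Qed.
End planar.

(** * Sliding arcs along the leaves *)

Section homotopy.
Context {R : realType}.
Implicit Types (a b c d s t x y X : R) (z w : plane R) (A B : vec R).
Implicit Types (lam : geodesic_lamination R) (L : set (plane R)).

Lemma leaf_eq lam L1 L2 z : leaves lam L1 -> leaves lam L2 -> L1 z -> L2 z ->
  L1 = L2.
Proof. by move=> l1 l2 z1 z2; apply: (leaf_disjoint l1 l2); exists z. Qed.

(** The condition on the slope is satisfied by every leaf when the axis of the
    chart is a leaf. *)
Definition leaf_line lam A B b m : Prop := `|m| <= `|b| /\
  exists2 L, leaves lam L & forall x y, x ^+ 2 + y ^+ 2 < 1 ->
    (L (chart A B x y) <-> y = b + m * x).

Lemma leaf_line0 lam A B : frame A B -> leaves lam (range (geo A B)) ->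
  leaf_line lam A B 0 0.
Proof.
move=> F l0; split=> //; exists (range (geo A B)) => // x y h.
by rewrite mul0r addr0; exact: chart_axis.
Qed.

(** A leaf other than the axis is disjoint from it, so its line crosses the line
    y = 0 outside the unit disk: |n1| <= |n0|. As the line does meet the unit disk,
    it is not vertical. *)
Lemma leaf_lineP lam A B L x y : frame A B -> leaves lam (range (geo A B)) ->
  leaves lam L -> x ^+ 2 + y ^+ 2 < 1 -> L (chart A B x y) ->
  exists b m, leaf_line lam A B b m /\ y = b + m * x.
Proof.
move=> F l0 lL hxy Lxy.
have [eL|nL] := pselect (L = range (geo A B)).
  exists 0, 0; split; first exact: leaf_line0.
  by rewrite mul0r addr0; apply/(chart_axis F hxy); rewrite -eL.
have [n0 [n1 [n2 [hn hL]]]] := chart_line F (leaf_geodesic lL).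
have n10 : `|n1| <= `|n0|.
  rewrite leNgt; apply/negP => h; apply: nL.
  have n1n : n1 != 0 by rewrite -normr_gt0; exact: le_lt_trans h.
  have hD : (- n0 / n1) ^+ 2 + 0 ^+ 2 < 1.
    rewrite expr0n addr0 -(real_normK (num_real (- n0 / n1))) expr_lt1//.
    by rewrite normrM normrN normfV ltr_pdivrMr ?normr_gt0// mul1r.
  apply: (@leaf_eq _ _ _ (chart A B (- n0 / n1) 0) lL l0).
    by apply/(hL _ _ hD); rewrite mulr0 addr0; field.
  exact/(chart_axis F hD).
have n2n : n2 != 0.
  apply/eqP => n20; move: hn; rewrite n20 expr0n addr0 => hn.
  have : n1 ^+ 2 <= n0 ^+ 2.
    by rewrite -(real_normK (num_real n1)) -(real_normK (num_real n0)) ler_sqr ?nnegrE.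
  lra.
have hline x' y' : n0 + n1 * x' + n2 * y' = 0 <-> y' = - n0 / n2 + - n1 / n2 * x'.
  split=> [h|->]; last by field.
  have -> : - n0 / n2 + - n1 / n2 * x' = - (n0 + n1 * x') / n2 by field.
  have -> : n0 + n1 * x' = - (n2 * y') by lra.
  by field.
exists (- n0 / n2), (- n1 / n2); split; last by apply/hline/(hL _ _ hxy).
split; first by rewrite !normrM !normrN; exact: ler_wpM2r.
exists L => // x' y' h'; rewrite hL//; exact: hline.
Qed.

Lemma leaf_line_cross lam A B b m b' m' x : frame A B ->
  leaf_line lam A B b m -> `|b| <= 1 / 100 -> leaf_line lam A B b' m' ->
  x ^+ 2 + (b + m * x) ^+ 2 < 1 -> b + m * x = b' + m' * x -> b = b' /\ m = m'.
Proof.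
move=> F [mb [L lL hL]] hb [_ [L' lL' hL']] hD e.
have eL : L = L'.
  by apply: (@leaf_eq _ _ _ (chart A B x (b + m * x)) lL lL'); [exact/(hL _ _ hD)|exact/(hL' _ _ hD)].
have hm : `|m| <= 1 / 100 by exact: le_trans mb hb.
move: hb hm; rewrite !ler_norml => /andP[b1 b2] /andP[m1 m2].
(* the two lines agree inside the disk; the abscissas 0 and 1/2 determine them *)
have key y : 0 <= y -> y <= 1 / 2 -> b + m * y = b' + m' * y.
  move=> y0 y1; have hy : y ^+ 2 + (b + m * y) ^+ 2 < 1.
    have h1 : b + m * y <= 1 / 2 by nra.
    have h2 : - (1 / 2) <= b + m * y by nra.
    nra.
  by apply/(hL' _ _ hy); rewrite -eL; apply/(hL _ _ hy).
have := key 0; have := key (1 / 2) => /(_ ltac:(lra) ltac:(lra)) h1.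
by move=> /(_ ltac:(lra) ltac:(lra)) h2; split; lra.
Qed.

Lemma lipschitz_continuous (T : topologicalType) (f : R -> R) (C : R) (g : T -> R) (p : T) :
  (forall b c, `|f b - f c| <= C * `|b - c|) -> {for p, continuous g} ->
  {for p, continuous (fun q => f (g q))}.
Proof.
move=> hf hg; apply: (continuous_comp hg).
apply/cvgrPdist_le => /= e e0.
have C0 : 0 <= C by have := hf 1 0; rewrite subr0 normr1 mulr1; apply: le_trans.
have C1 : 0 < C + 1 by rewrite ltr_wpDl.
near=> b; apply: le_trans (hf _ _) _.
apply: (@le_trans _ _ ((C + 1) * `|g p - b|)).
  by apply: ler_wpM2r => //; rewrite lerDl.
rewrite mulrC -ler_pdivlMr//; near: b.
apply: (@pseudometric_normed_Zmodule.cvgr_dist_le _ _ _ (nbhs (g p)) _ id (g p)).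
  exact: cvg_id.
by rewrite divr_gt0.
Unshelve. all: by end_near.
Qed.

Lemma geo_inj A B : frame A B -> injective (geo A B).
Proof.
move=> F s t e; have := hyp_dist_geo s t F; rewrite e hyp_dist_geo// subrr normr0.
by move=> /esym/eqP; rewrite normr_eq0 subr_eq0 => /eqP.
Qed.

(** In a chart a geodesic through the origin is parametrized by tanh of arc length;
    hence this criterion, in terms of an increasing continuous function v, for a
    path to run once through a geodesic arc. *)
Lemma arc_bij A B (f : R -> plane R) (v : R -> R) (e u0 u1 : R) :
  frame A B -> 0 < e ->
  (forall s u, s \in `[0, 1] -> e * tanh u = v s -> f s = geo A B u) ->
  (forall s t, s \in `[0, 1] -> t \in `[0, 1] -> s < t -> v s < v t) ->
  (forall s, s \in `[0, 1] -> {for s, continuous v}) ->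
  v 0 = e * tanh u0 -> v 1 = e * tanh u1 ->
  set_bij `[0, 1] (geo A B @` `[u0, u1]) f.
Proof.
move=> F e0 hf hv cv v0 v1.
have i0 : (0 : R) \in `[0, 1] by rewrite in_itv/= lexx ler01.
have i1 : (1 : R) \in `[0, 1] by rewrite in_itv/= lexx ler01.
have vle s t : s \in `[0, 1] -> t \in `[0, 1] -> s <= t -> v s <= v t.
  by move=> hs ht; rewrite le_eqVlt => /predU1P[->//|/(hv _ _ hs ht)/ltW].
have between s : s \in `[0, 1] -> exists2 u, u \in `[u0, u1] & e * tanh u = v s.
  move=> hs; have := hs; rewrite in_itv/= => /andP[s0 s1].
  have h0 := vle _ _ i0 hs s0; have h1 := vle _ _ hs i1 s1.
  rewrite v0 in h0; rewrite v1 in h1.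
  have h0' : tanh u0 <= v s / e by rewrite ler_pdivlMr// mulrC.
  have h1' : v s / e <= tanh u1 by rewrite ler_pdivrMr// mulrC.
  have [|u hu] := @tanh_surj R (v s / e).
    have a0 := tanh_sqr_lt1 u0; have a1 := tanh_sqr_lt1 u1.
    have [p0|p0] := leP 0 (v s / e); nra.
  exists u; last by rewrite hu mulrC divfK// gt_eqF.
  by rewrite in_itv/= -(tanh_le u0 u) -(tanh_le u u1) hu h0' h1'.
split.
- move=> s /= hs; have [u hu eu] := between s hs.
  by exists u; [exact: hu|rewrite (hf s u)].
- move=> s t; rewrite !inE /= => hs ht.
  have [us _ es] := between s hs; have [ut _ et] := between t ht.
  rewrite (hf s us)// (hf t ut)// => /(geo_inj F) e'.
  have vst : v s = v t by rewrite -es -et e'.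
  by case: (ltgtP s t) => // [/(hv _ _ hs ht)|/(hv _ _ ht hs)]; rewrite vst ltxx.
- move=> _ [u /= hu <-]; have := hu; rewrite in_itv/= => /andP[hu0 hu1].
  have hlo : v 0 <= e * tanh u by rewrite v0 ler_pM2l// tanh_le.
  have hhi : e * tanh u <= v 1 by rewrite v1 ler_pM2l// tanh_le.
  have v01 : v 0 <= v 1 by exact: vle.
  have [||s hs es] := @IVT R v 0 1 (e * tanh u) ler01.
  + exact: itv01_continuous.
  + by rewrite min_l// max_r// hlo hhi.
  by exists s => //=; rewrite (hf s u).
Qed.

End homotopy.

(** The line of intercept b and slope mh b meets the transversal x = kap y at
    height kk b = b / (1 - kap mh b). The next two lemmas say that for small b this
    is an increasing reparametrization of b, close to the identity. *)
Lemma slanted_denominator (R : realType) (mh : R -> R) (kap r b : R) :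
  (forall b, `|mh b| <= 4 * `|b|) -> r * `|kap| <= 1 / 1000 -> `|b| <= r ->
  249 / 250 <= 1 - kap * mh b <= 251 / 250.
Proof.
move=> mhb hk br.
have : `|kap * mh b| <= 1 / 250.
  rewrite normrM; have h1 : `|mh b| <= 4 * r by have := mhb b; lra.
  have : `|kap| * `|mh b| <= `|kap| * (4 * r) by rewrite ler_wpM2l.
  clear -hk; lra.
by rewrite ler_norml => /andP[? ?]; apply/andP; split; lra.
Qed.

Lemma slanted_coordinate (R : realType) (mh : R -> R) (kap r : R) :
  mh 0 = 0 -> (forall b c, `|mh b - mh c| <= 4 * `|b - c|) ->
  0 < r -> r * `|kap| <= 1 / 1000 ->
  exists2 kk, kk = (fun b => b / (1 - kap * mh b)) &
  [/\ forall b, `|b| <= r -> 1 - kap * mh b != 0 /\ b = kk b * (1 - kap * mh b),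
    forall b, `|b| <= r -> `|kk b| <= 2 * r,
    forall b b', `|b| <= r -> `|b'| <= r -> b < b' -> kk b < kk b' &
    kk (- r) <= - (r / 2) /\ r / 2 <= kk r].
Proof.
move=> mh0 mhL r0 hk.
have mhb b : `|mh b| <= 4 * `|b| by have := mhL b 0; rewrite mh0 !subr0.
have den b : `|b| <= r -> 249 / 250 <= 1 - kap * mh b <= 251 / 250.
  exact: slanted_denominator.
have den0 b : `|b| <= r -> 0 < 1 - kap * mh b.
  by move=> /den/andP[h _]; apply: lt_le_trans h.
have nr : `|r| <= r by rewrite gtr0_norm.
have nNr : `|- r| <= r by rewrite normrN.
pose kk b := b / (1 - kap * mh b).
exists kk => //; split.
- by move=> b /den0 ?; rewrite /kk divfK ?gt_eqF.
- move=> b br; have /andP[h1 _] := den _ br; have h2 := den0 _ br.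
  rewrite /kk normrM normfV (gtr0_norm h2) ler_pdivrMr//; clear -h1 h2 br r0; nra.
- move=> b b' br br' bb'; rewrite /kk ltr_pdivrMr ?den0// mulrAC ltr_pdivlMr ?den0//.
  have h1 : `|b * (kap * (mh b' - mh b))| <= (1 / 250) * (b' - b).
    rewrite !normrM; have h2 := mhL b' b; rewrite [X in _ <= 4 * X]gtr0_norm ?subr_gt0// in h2.
    have h3 : `|b| * `|kap| <= 1 / 1000.
      by apply: le_trans hk; rewrite ler_wpM2r.
    rewrite mulrA; have : `|b| * `|kap| * `|mh b' - mh b| <= 1 / 1000 * (4 * (b' - b)).
      by apply: ler_pM => //; rewrite mulr_ge0.
    clear; lra.
  have /andP[h4 _] := den _ br; move: h1; rewrite ler_norml => /andP[h1 _].
  have h5 : 249 / 250 * (b' - b) <= (1 - kap * mh b) * (b' - b) by rewrite ler_pM2r ?subr_gt0.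
  clear -h1 h5 bb'; lra.
- split.
  + have /andP[_ h1] := den _ nNr; have h2 := den0 _ nNr.
    rewrite /kk ler_pdivrMr//; clear -h1 h2 r0; nra.
  + have /andP[_ h1] := den _ nr; have h2 := den0 _ nr.
    rewrite /kk ler_pdivlMr//; clear -h1 h2 r0; nra.
Qed.

Lemma strip_in_disk (R : realType) (h X b m x : R) : 0 < h -> 0 < X ->
  1 / 100 <= X -> X ^+ 2 = 1 - 100 * h ^+ 2 -> `|b| <= h / 10 -> `|m| <= 4 * `|b| ->
  - (1 / 100) <= x -> x <= X ->
  `|b + m * x| <= h / 2 /\ x ^+ 2 + (b + m * x) ^+ 2 < 1.
Proof.
move=> h0 X0 Xge hX br mb x0 x1.
have h2_gt0 : 0 < h ^+ 2 by rewrite exprn_gt0.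
have X1 : X < 1 by rewrite -ltr_sqr ?nnegrE ?ltW// hX; lra.
have nx : `|x| <= X by rewrite ler_norml; apply/andP; split; lra.
have ny : `|b + m * x| <= h / 2.
  apply: le_trans (ler_normD _ _) _; rewrite normrM.
  have : `|m| * `|x| <= 4 * (h / 10) * 1.
    by apply: ler_pM => //; [lra|exact: le_trans nx (ltW X1)].
  lra.
split=> //.
have h1 : x ^+ 2 <= X ^+ 2.
  by rewrite -(real_normK (num_real x)) ler_sqr ?nnegrE// ltW.
have h2 : (b + m * x) ^+ 2 <= (h / 2) ^+ 2.
  by rewrite -(real_normK (num_real (b + m * x))) ler_sqr ?nnegrE// divr_ge0// ltW.
have h3 : (h / 2) ^+ 2 = h ^+ 2 / 4 by rewrite expr_div_n -natrX.
rewrite hX in h1; rewrite h3 in h2; clear -h1 h2 h2_gt0; lra.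
Qed.

Lemma convex_between (R : realType) (x X t : R) : x <= X -> 0 <= t -> t <= 1 ->
  x <= (1 - t) * x + t * X <= X.
Proof. by move=> xX t0 t1; apply/andP; split; nra. Qed.

Section holonomy.
Context {R : realType}.
Implicit Types (a b c d s t x y X : R) (z w : plane R) (A B : vec R).
Implicit Types (lam : geodesic_lamination R) (L : set (plane R)).

(** A neighbourhood of the origin in a transversal of direction (c, d), of size
    about h, slides along the leaves into a short arc orthogonal to the axis at
    distance of order log (1 / h). The homotopy moves the point of intercept b
    along the line of slope mh b given by [slope_extension], so a point of a leaf
    stays on its leaf and any other point avoids all leaves. The vertical
    chord through (X, 0) has half-length sqrt (1 - X^2) = 10h, so that its part in
    the strip |y| <= h / 2 has bounded hyperbolic length. *)
Lemma holonomy lam A B c d h X :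
  frame A B -> leaves lam (range (geo A B)) -> c ^+ 2 + d ^+ 2 = 1 -> 0 < d ->
  0 < h -> h <= 1 / 100 -> h * (`|c| / d) <= 1 / 100 ->
  0 < X -> X ^+ 2 = 1 - 100 * h ^+ 2 ->
  exists H u0 u1 v0 v1,
   [/\ foliation_homotopy lam H (geo A (comb A B 0 c d) @` `[u0, u1])
        (geo (comb A B (10 * h)^-1 (X / (10 * h)) 0) (cross A B) @` `[v0, v1]),
     - (h / 5) <= d * tanh u0 /\ d * tanh u0 <= - (h / 20),
     h / 20 <= d * tanh u1 /\ d * tanh u1 <= h / 5,
     v0 < v1 &
     - (1 / 20) <= tanh v0 /\ tanh v1 <= 1 / 20].
Proof.
move=> F l0 hcd d0 h0 hh hhk X0 hX.
have [mh [mhE mhL mono mhC]] := slope_extension (leaf_line0 F l0)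
  (fun b m (l : leaf_line lam A B b m) => l.1)
  (fun b m b' m' x lb bh => leaf_line_cross F lb (le_trans bh hh)) h0 hh X0 hX.
have mh0 : mh 0 = 0 by apply: mhE (leaf_line0 F l0) _; rewrite normr0 ltW.
have mhb b : `|mh b| <= 4 * `|b| by have := mhL b 0; rewrite mh0 !subr0.
have [kap ekap] : exists kap, kap = c / d by exists (c / d).
have hk : h * `|kap| <= 1 / 100 by rewrite ekap normrM normfV (gtr0_norm d0).
have [r er] : exists r, r = h / 10 by exists (h / 10).
have r0 : 0 < r by rewrite er divr_gt0.
have ler_h : r <= h / 10 by rewrite er.
have rk : r * `|kap| <= 1 / 1000 by rewrite er; clear -hk; lra.
have [kk ekk [kkE kk_abs kk_lt [kk0 kk1]]] := slanted_coordinate mh0 mhL r0 rk.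
(* the homotopy is parametrized by intercepts: s in [0, 1] gives bb s in [-r, r] *)
pose bb s := - r + 2 * r * s.
have bb_lt s t : s < t -> bb s < bb t.
  by move=> st; rewrite /bb ltrD2l ltr_pM2l// mulr_gt0.
have bbr s : s \in `[0, 1] -> `|bb s| <= r.
  rewrite in_itv/= => /andP[s0 s1]; rewrite /bb ler_norml.
  by clear -r0 s0 s1; apply/andP; split; nra.
(* (xi b, kk b) is on the transversal and on the line of intercept b *)
pose xi b := kap * kk b.
have xi_abs b : `|b| <= r -> `|xi b| <= 1 / 100.
  move=> br; rewrite /xi normrM; have : `|kap| * `|kk b| <= `|kap| * (2 * r).
    by rewrite ler_wpM2l// kk_abs.
  by clear -rk; lra.
have h2_le : h ^+ 2 <= 1 / 10000.
  have -> : 1 / 10000 = (1 / 100) ^+ 2 :> R by rewrite expr_div_n expr1n -natrX.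
  by rewrite ler_sqr// ?nnegrE ?ltW.
have Xge : 1 / 100 <= X.
  rewrite -ler_sqr ?nnegrE//; last exact: ltW.
  by rewrite hX expr_div_n; clear -h2_le; lra.
have in_D b x : `|b| <= r -> - (1 / 100) <= x -> x <= X ->
    `|b + mh b * x| <= h / 2 /\ x ^+ 2 + (b + mh b * x) ^+ 2 < 1.
  by rewrite er => br x0 x1; exact: (@strip_in_disk _ h X).
have xi_in b : `|b| <= r -> - (1 / 100) <= xi b /\ xi b <= X.
  by move=> /xi_abs; rewrite ler_norml => /andP[? h1]; split=> //; exact: le_trans Xge.
pose xx (p : R * R) := (1 - p.1) * xi (bb p.2) + p.1 * X.
pose yy (p : R * R) := bb p.2 + mh (bb p.2) * xx p.
have xx_in t s : t \in `[0, 1] -> s \in `[0, 1] -> - (1 / 100) <= xx (t, s) <= X.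
  rewrite in_itv/= => /andP[t0 t1] /bbr/xi_in[x0 x1].
  have /andP[h1 h2] := convex_between x1 t0 t1.
  by rewrite /xx/= h2 (le_trans x0 h1).
have HD t s : t \in `[0, 1] -> s \in `[0, 1] -> xx (t, s) ^+ 2 + yy (t, s) ^+ 2 < 1.
  by move=> ht hs; have /andP[? ?] := xx_in _ _ ht hs; apply: (in_D _ _ _ _ _).2 => //; exact: bbr.
pose H p := chart A B (xx p) (yy p).
have cbb s : {for s, continuous bb}.
  by apply: cvgD; [exact: cvg_cst|apply: cvgM; [exact: cvg_cst|exact: cvg_id]].
have cmh s : {for s, continuous (fun s => mh (bb s))}.
  exact: lipschitz_continuous mhL (cbb s).
have ckk s : s \in `[0, 1] -> {for s, continuous (fun s => kk (bb s))}.
  move=> hs; rewrite ekk; apply: cvgM; first exact: cbb.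
  apply: cvgV; first by have [] := kkE _ (bbr _ hs).
  by apply: cvgB; [exact: cvg_cst|apply: cvgM; [exact: cvg_cst|exact: cmh]].
pose q := 10 * h.
have q0 : 0 < q by rewrite mulr_gt0.
have hq : q ^+ 2 = 1 - X ^+ 2 by rewrite hX /q exprMn -natrX; ring.
have i0 : (0 : R) \in `[0, 1] by rewrite in_itv/= lexx ler01.
have i1 : (1 : R) \in `[0, 1] by rewrite in_itv/= lexx ler01.
have e_b0 : bb 0 = - r by rewrite /bb mulr0 addr0.
have e_b1 : bb 1 = r by rewrite /bb mulr1; ring.
have nr : `|r| <= r by rewrite gtr0_norm.
have nNr : `|- r| <= r by rewrite normrN.
have kk_tanh b : `|b| <= r -> exists u, d * tanh u = kk b.
  move=> br; have [x0 x1] := xi_in _ br; have [_ hD] := in_D _ _ br x0 x1.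
  have [|u hu] := @tanh_surj R (kk b / d); last first.
    by exists u; rewrite hu mulrC divfK// gt_eqF.
  move: hD; have -> : b + mh b * xi b = kk b.
    by rewrite {1}(kkE _ br).2 /xi; ring.
  rewrite /xi ekap.
  have -> : (c / d * kk b) ^+ 2 + kk b ^+ 2 = (kk b / d) ^+ 2 * (c ^+ 2 + d ^+ 2).
    by field; rewrite gt_eqF.
  by rewrite hcd mulr1.
pose V b := b + mh b * X.
have Xneg : - (1 / 100) <= X by clear -Xge; lra.
have V_tanh b : `|b| <= r -> exists u, q * tanh u = V b /\ `|tanh u| <= 1 / 20.
  move=> br; have [hV _] := in_D _ _ br Xneg (lexx X).
  have hVq : `|V b / q| <= 1 / 20.
    rewrite normrM normfV (gtr0_norm q0) ler_pdivrMr//.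
    by apply: le_trans hV _; rewrite /q; clear; lra.
  have [|u hu] := @tanh_surj R (V b / q).
    rewrite -(real_normK (num_real _)) expr_lt1//; apply: le_lt_trans hVq _.
    by clear; lra.
  by exists u; rewrite hu mulrC divfK// gt_eqF.
have [u0 hu0] := kk_tanh _ nNr.
have [u1 hu1] := kk_tanh _ nr.
have [v0 [hv0 nv0]] := V_tanh _ nNr.
have [v1 [hv1 nv1]] := V_tanh _ nr.
exists H, u0, u1, v0, v1; split.
- split.
  + apply: continuous_in_subspaceT => -[t s]; rewrite inE/= => -[ht hs].
    have c1 : {for (t, s), continuous (fun p : R * R => p.1)} by exact: cvg_fst.
    have c2 : {for (t, s), continuous (fun p : R * R => p.2)} by exact: cvg_snd.
    have cb : {for (t, s), continuous (fun p : R * R => bb p.2)}.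
      exact: continuous_comp c2 (cbb _).
    have cm : {for (t, s), continuous (fun p : R * R => mh (bb p.2))}.
      exact: continuous_comp c2 (cmh _).
    have ck : {for (t, s), continuous (fun p : R * R => kk (bb p.2))}.
      exact: continuous_comp c2 (ckk _ hs).
    have cx : {for (t, s), continuous xx}.
      apply: cvgD; last by apply: cvgM; [exact: c1|exact: cvg_cst].
      apply: cvgM; first by apply: cvgB; [exact: cvg_cst|exact: c1].
      by apply: cvgM; [exact: cvg_cst|exact: ck].
    have cy : {for (t, s), continuous yy}.
      by apply: cvgD; [exact: cb|apply: cvgM; [exact: cm|exact: cx]].
    by apply: chart_continuous => //; exact: HD.
  + apply: (@arc_bij R A (comb A B 0 c d) _ (fun s => kk (bb s)) d).
    * exact: frame_dir.
    * exact: d0.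
    * move=> s u hs hu; rewrite geo_dir// /H /yy /xx/= subr0 mul1r mul0r addr0.
      have e1 : xi (bb s) = c * tanh u by rewrite /xi -hu ekap; field; rewrite gt_eqF.
      rewrite e1 hu; congr chart.
      by rewrite -e1 {1}(kkE _ (bbr _ hs)).2 /xi; ring.
    * by move=> s t hs ht st; apply: kk_lt; [exact: bbr|exact: bbr|exact: bb_lt].
    * exact: ckk.
    * by rewrite e_b0.
    * by rewrite e_b1.
  + apply: (@arc_bij R (comb A B q^-1 (X / q) 0) (cross A B) _ (fun s => V (bb s)) q).
    * exact: frame_vert.
    * exact: q0.
    * move=> s u hs hu; rewrite geo_vert// hu /H /yy /xx/= subrr mul0r add0r mul1r//.
    * by move=> s t _ _ st; apply: mono => //; exact: bb_lt.
    * move=> s hs; apply: cvgD; first exact: cbb.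
      by apply: cvgM; [exact: cmh|exact: cvg_cst].
    * by rewrite e_b0.
    * by rewrite e_b1.
  + by move=> t s ht hs; apply: chart_disk => //; exact: HD.
  + move=> s hs.
    have [[m lm]|nl] := pselect (exists m, leaf_line lam A B (bb s) m).
      left; have em : mh (bb s) = m.
        by apply: mhE => //; apply: le_trans (bbr _ hs) _; rewrite er; clear -h0; lra.
      have [_ [L lL hL]] := lm; exists L => // t ht.
      by apply/hL; [exact: HD|rewrite /yy em].
    right => t ht [L lL Lz]; apply: nl.
    have [b' [m' [l' e]]] := leaf_lineP F l0 lL (HD _ _ ht hs) Lz.
    have /andP[x0 x1] := xx_in _ _ ht hs.
    have [eb _] := mhC (bb s) _ _ _ (le_trans (bbr _ hs) ler_h) x0 x1 l' e.
    by exists m'; rewrite -eb.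
- rewrite hu0; have := kk_abs _ nNr; rewrite ler_norml => /andP[h1 _].
  by move: kk0 h1; rewrite er; clear; split; lra.
- rewrite hu1; have := kk_abs _ nr; rewrite ler_norml => /andP[_ h1].
  by move: kk1 h1; rewrite er; clear; split; lra.
- rewrite -tanh_lt -(ltr_pM2l q0) hv0 hv1; apply: mono => //.
  by clear -r0; lra.
- by move: nv0 nv1; rewrite !ler_norml => /andP[? _] /andP[_ ?].
Qed.

End holonomy.

(** * Arcs transverse to a lamination *)

Section arcs.
Context {R : realType}.
Implicit Types (a b c d s t x y X : R) (z w : plane R) (A B : vec R).
Implicit Types (lam : geodesic_lamination R) (L : set (plane R)).

Lemma geo_continuous A B : frame A B -> continuous (geo A B).
Proof.
move=> F t; have lin a b (e : R) : {for t, continuous (fun s => cosh s * a + sinh s * b + 0 * e)}.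
  apply: cvgD; last exact: cvg_cst.
  by apply: cvgD; apply: cvgM; first [exact: cvg_cst|exact: is_derive_continuous (is_derive_cosh t)|exact: is_derive_continuous (is_derive_sinh t)].
exact: (proj_continuous (lin _ _ _) (lin _ _ _) (lin _ _ _) (geo_future t F)).
Qed.

Lemma closed_measurable (E : set (borel_plane R)) : closed (E : set (plane R)) -> measurable E.
Proof.
move=> cE; rewrite -(setCK E); apply: measurableC.
by apply: sub_sigma_algebra; exact: closed_openC.
Qed.

Lemma arc_measurable A B (u0 u1 : R) : frame A B ->
  measurable (geo A B @` `[u0, u1] : set (borel_plane R)).
Proof.
move=> F; apply: closed_measurable; apply: compact_closed; first exact: norm_hausdorff.
apply: continuous_compact; last exact: segment_compact.
by apply: continuous_subspaceT; exact: geo_continuous.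
Qed.

Lemma arc_of_length_geo A B (u0 u1 : R) : frame A B -> u0 < u1 ->
  arc_of_length (u1 - u0) (geo A B @` `[u0, u1]).
Proof.
move=> F u01; exists (fun t => geo A B (u0 + t)); split; first by rewrite subr_gt0.
  split=> [t _|s t _ _]; first exact: geo_disk.
  by rewrite hyp_dist_geo// opprD addrACA subrr add0r.
apply/seteqP; split=> [_ [u hu <-]|_ [t ht <-]].
  exists (u - u0); last by rewrite addrC subrK.
  by move: hu; rewrite /= !in_itv/= subr_ge0 lerD2r.
exists (u0 + t) => //; move: ht; rewrite /= !in_itv/= => /andP[? ?].
by rewrite lerDl -lerBrDl; apply/andP.
Qed.

Lemma arc_subset A B (u0 u1 v0 v1 : R) : v0 <= u0 -> u1 <= v1 ->
  geo A B @` `[u0, u1] `<=` geo A B @` `[v0, v1].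
Proof.
move=> h0 h1 _ [t + <-] => /=; rewrite in_itv/= => /andP[t0 t1].
by exists t => //=; rewrite in_itv/= (le_trans h0)//= (le_trans t1).
Qed.

Lemma geo_chart A B t : frame A B -> geo A B t = chart A B (tanh t) 0.
Proof.
move=> F; have := @geo_dir _ A B 1 0 t F; rewrite mul1r mul0r => <-.
have -> : comb A B 0 1 0 = B; last by [].
by rewrite /comb; case: B {F} => -[b0 b1] b2 /=; congr (_, _, _); ring.
Qed.

(** In the chart of the first geodesic both are lines, and two lines with two common
    points are equal. *)
Lemma geo_sub_geodesic A B s t L : frame A B -> complete_geodesic L -> s < t ->
  L (geo A B s) -> L (geo A B t) -> forall u, L (geo A B u).
Proof.
move=> F cL st; have [n0 [n1 [n2 [hn hL]]]] := chart_line F cL.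
have hD u : tanh u ^+ 2 + 0 ^+ 2 < 1 :> R by rewrite expr0n addr0 tanh_sqr_lt1.
rewrite !geo_chart// => /(hL _ _ (hD s)) hs /(hL _ _ (hD t)) ht u.
rewrite geo_chart//; apply/(hL _ _ (hD u)).
have n10 : n1 = 0.
  have /eqP : n1 * (tanh t - tanh s) = 0 by lra.
  by rewrite mulf_eq0 subr_eq0 (gt_eqF (_ : tanh s < tanh t)) ?tanh_lt// orbF => /eqP.
by move: hs; rewrite n10; lra.
Qed.

Lemma arc_transverse lam A B (s t u0 u1 : R) : frame A B -> s < t ->
  ~ (exists2 L, leaves lam L & geo A B @` `[s, t] `<=` L) -> u0 < u1 ->
  transverse_arc lam (geo A B @` `[u0, u1]).
Proof.
move=> F st hn u01; split.
  by exists (u1 - u0); exact: arc_of_length_geo.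
move=> [L lL hL]; apply: hn; exists L => // _ [u _ <-].
apply: (geo_sub_geodesic F (leaf_geodesic lL) u01); apply: hL.
  by exists u0 => //; rewrite /= in_itv/= lexx ltW.
by exists u1 => //; rewrite /= in_itv/= lexx ltW.
Qed.

Lemma chart_inside X q : 0 < q -> q ^+ 2 = 1 - X ^+ 2 ->
  forall u, X ^+ 2 + (q * tanh u) ^+ 2 < 1.
Proof.
move=> q0 hq u; rewrite exprMn hq; have := tanh_sqr_lt1 u.
have : 0 < 1 - X ^+ 2 by rewrite -hq exprn_gt0.
nra.
Qed.

(** A leaf containing an arc of the vertical chord through (X, 0) would meet the
    axis, hence be the axis. *)
Lemma vertical_transverse lam A B X q (v0 v1 : R) : frame A B ->
  leaves lam (range (geo A B)) -> 0 < q -> q ^+ 2 = 1 - X ^+ 2 -> v0 < v1 ->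
  transverse_arc lam (geo (comb A B q^-1 (X / q) 0) (cross A B) @` `[v0, v1]).
Proof.
move=> F l0 q0 hq; apply: (@arc_transverse _ _ _ 0 1) => //; first exact: frame_vert.
have hD := chart_inside q0 hq.
move=> [L lL hL].
have h0 : L (chart A B X (q * tanh 0)).
  by rewrite -geo_vert//; apply: hL; exists 0 => //; rewrite /= in_itv/= lexx ler01.
have h1 : L (chart A B X (q * tanh 1)).
  by rewrite -geo_vert//; apply: hL; exists 1 => //; rewrite /= in_itv/= lexx ler01.
have eL : L = range (geo A B).
  apply: (leaf_eq lL l0 h0); apply/(chart_axis F (hD 0)).
  by rewrite tanh0 mulr0.
move: h1; rewrite eL => /(chart_axis F (hD 1))/eqP.
have t1 : 0 < tanh (1 : R) by rewrite -(@tanh0 R) tanh_lt.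
by rewrite mulf_eq0 (gt_eqF q0) (gt_eqF t1).
Qed.

Lemma frame_shift A B s : frame A B ->
  frame (comb A B (cosh s) (sinh s) 0) (comb A B (sinh s) (cosh s) 0).
Proof.
move=> F; have hs := cosh_sqr s; split.
- by rewrite lor_comb2// -!expr2 hs; ring.
- by rewrite lor_comb2// -!expr2 hs; ring.
- by rewrite lor_comb2//; ring.
- by have [] := geo_future s F.
Qed.

Lemma geo_shift A B s t : frame A B ->
  geo (comb A B (cosh s) (sinh s) 0) (comb A B (sinh s) (cosh s) 0) t = geo A B (s + t).
Proof.
move=> F; rewrite /geo; congr proj; rewrite coshD sinhD.
by rewrite /comb/=; congr (_, _, _); ring.
Qed.

(** The leaf through a point of a geodesic which is not a leaf becomes the axis of
    a chart in which the geodesic leaves the origin in the direction (c, d).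
    Reversing the leaf makes d positive. *)
Lemma adapted_frame lam A B0 L : frame A B0 -> leaves lam L -> L (proj A) ->
  ~ (forall t, L (geo A B0 t)) ->
  exists B c d, [/\ frame A B, leaves lam (range (geo A B)),
    B0 = comb A B 0 c d, c ^+ 2 + d ^+ 2 = 1 & 0 < d].
Proof.
move=> F0 lL Lz hn; have [hA hB0 hAB0 A0] := F0.
have [B F eL] : exists2 B, frame A B & L = range (geo A B).
  have [B] := complete_geodesicE (leaf_geodesic lL) Lz.
  by rewrite unit_lift_proj// => *; exists B.
have dec B' : frame A B' -> B0 = comb A B' 0 (lor B0 B') (lor B0 (cross A B')).
  by move=> F'; rewrite {1}(comb_complete B0 F') (lorC B0 A) hAB0 oppr0.
have norm B' : frame A B' -> lor B0 B' ^+ 2 + lor B0 (cross A B') ^+ 2 = 1.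
  move=> F'; have := lor_comb2 0 (lor B0 B') (lor B0 (cross A B'))
    0 (lor B0 B') (lor B0 (cross A B')) F'.
  by rewrite -dec// hB0 => h; lra.
pose d := lor B0 (cross A B).
have d0 : d != 0.
  apply/eqP => d0; apply: hn => t; rewrite eL (dec _ F) geo_dir//.
  apply/chart_axis => //; rewrite -/d d0 ?mul0r// expr0n addr0 exprMn.
  have -> : lor B0 B ^+ 2 = 1 by have := norm _ F; rewrite -/d d0; lra.
  by rewrite mul1r tanh_sqr_lt1.
have [dneg|dpos|/eqP] := ltrgtP d 0; last by rewrite (negbTE d0).
- pose B' := scal (-1) B.
  have F' : frame A B'.
    have [_ hB hAB _] := F; split=> //.
      by rewrite lor_scal lorC lor_scal hB; ring.
    by rewrite lorC lor_scal lorC hAB mulr0.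
  exists B', (lor B0 B'), (lor B0 (cross A B')); split=> //.
  + have -> : range (geo A B') = range (geo A B); last by rewrite -eL.
    have e t : geo A B' t = geo A B (- t).
      rewrite /geo; congr proj; rewrite coshN sinhN /comb /B' /scal/=.
      by congr (_, _, _); ring.
    apply/seteqP; split=> _ [t _ <-]; first by exists (- t); rewrite ?e.
    by exists (- t) => //; rewrite e opprK.
  + exact: dec.
  + exact: norm.
  + have -> : lor B0 (cross A B') = - d by rewrite /d /lor /B' /scal/=; ring.
    by rewrite oppr_gt0.
- exists B, (lor B0 B), d; split=> //; [by rewrite -eL|exact: dec|exact: norm].
Qed.

End arcs.

(** * The transverse measures have density zero *)

Section flatness.
Context {R : realType}.

Definition flat_at (F : R -> R) (s : R) : Prop :=
  forall e : R, 0 < e -> exists2 d : R, 0 < d &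
    forall t, `|t - s| < d -> `|F t - F s| <= e * `|t - s|.

Lemma flat_is_derive (F : R -> R) (s : R) : flat_at F s -> is_derive s 1 F 0.
Proof.
move=> hF.
have h : h^-1 *: ((F \o shift s) (h *: (1 : R)) - F s) @[h --> 0^'] --> (0 : R).
  apply/cvgrPdist_le => /= e e0; have [d d0 hd] := hF e e0.
  near=> h; have hn : h != 0 by near: h; exact: nbhs_dnbhs_neq.
  rewrite sub0r normrN normrM normfV ler_pdivrMl ?normr_gt0// mulrC.
  rewrite /GRing.scale/= mulr1; have := hd (h + s); rewrite addrK; apply.
  near: h; apply: dnbhs0_lt; exact: d0.
split; first by apply/cvg_ex; exists 0.
exact/cvg_lim.
Unshelve. all: by end_near.
Qed.

Lemma flat_constant (F : R -> R) (a b : R) : a <= b ->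
  (forall s, a <= s <= b -> flat_at F s) -> F a = F b.
Proof.
move=> ab hF; have dF s : s \in `[a, b] -> is_derive s 1 F 0.
  by rewrite in_itv/= => hs; exact/flat_is_derive/hF.
have cF : {within `[a, b], continuous F}.
  by apply: continuous_in_subspaceT => s; rewrite inE/= => /dF h; exact: is_derive_continuous h.
have dF' s : s \in `]a, b[%R -> is_derive s 1 F ((fun=> 0) s).
  by move=> /subset_itv_oo_cc hs; exact: dF.
have [c _] := MVT_segment ab dF' cF.
by rewrite mul0r => /eqP; rewrite subr_eq0 => /eqP.
Qed.

End flatness.

Section density.
Context {R : realType}.
Implicit Types (mu : measured_lamination R).

Lemma set_bij_image (T U : Type) (E : set T) (E' : set U) (f : T -> U) :
  set_bij E E' f -> f @` E = E'.
Proof.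
move=> [h _ h']; apply/seteqP; split=> [_ [x Ex <-]|]; first exact: h.
exact: h'.
Qed.

Lemma homotopy_mass mu I J H : transverse_arc (lamination mu) I ->
  transverse_arc (lamination mu) J -> foliation_homotopy (lamination mu) H I J ->
  tmeasure mu I I = tmeasure mu J J.
Proof.
move=> tI tJ hH; have [_ b0 b1 _ _] := hH.
have := tmeasure_homotopy tI tJ hH (measurable_itv `[0, 1]%R) (@subset_refl _ _).
by rewrite (set_bij_image b0) (set_bij_image b1).
Qed.

(** At a point off the lamination the measure vanishes in a neighbourhood. At a
    point of a leaf, the arc of radius r slides along that leaf, by [holonomy] with
    h = 40r, into an orthogonal arc of length 1 whose Euclidean depth is at most a
    constant times r; the mass of the latter is at most e r for small r. The
    constant depends on the point, which does no harm because only the derivative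
    at each point matters. *)
Lemma zero_density mu (hmu : is_little_o_delta mu) A0 B0 (a b s0 : R) :
  frame A0 B0 -> a < s0 -> s0 < b ->
  (forall L, leaves (lamination mu) L -> ~ (forall t, L (geo A0 B0 t))) ->
  forall e : R, 0 < e -> exists2 d : R, 0 < d & forall r, 0 < r -> r < d ->
    (tmeasure mu (geo A0 B0 @` `[a, b]) (geo A0 B0 @` `[(s0 - r)%R, (s0 + r)%R])
     <= (e * r)%:E)%E.
Proof.
move=> F0 as0 s0b hn e e0.
have ab : a < b by exact: lt_trans s0b.
have tr (u0 u1 : R) : u0 < u1 -> transverse_arc (lamination mu) (geo A0 B0 @` `[u0, u1]).
  move=> u01; apply: (@arc_transverse _ _ _ _ 0 1) => //.
  move=> [L lL hL]; apply: (hn L lL).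
  apply: (geo_sub_geodesic F0 (leaf_geodesic lL) ltr01); apply: hL.
    by exists 0 => //; rewrite /= in_itv/= lexx ler01.
  by exists 1 => //; rewrite /= in_itv/= lexx ler01.
set I := geo A0 B0 @` `[a, b]; set nu := tmeasure mu I.
have [[L lL Lz]|nL] := pselect (lam_support (lamination mu) (geo A0 B0 s0)); last first.
  have : ~ measure_support nu (geo A0 B0 s0).
    by move=> /(tmeasure_support (tr _ _ ab))[].
  move=> /existsNP[U] /not_implyP[oU] /not_implyP[Us] /negP; rewrite -leNgt => U0.
  have : nbhs (geo A0 B0 s0) U by exact: open_nbhs_nbhs.
  move=> /(geo_continuous F0) /nbhs_ballP[d /= d0 hd].
  exists d => // r r0 rd; apply: (@le_trans _ _ 0%E); last first.
    by rewrite lee_fin mulr_ge0// ltW.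
  apply: le_trans U0; apply: le_measure; rewrite ?inE.
  - exact: arc_measurable.
  - by apply: sub_sigma_algebra.
  - move=> _ [t + <-]; rewrite /= in_itv/= => /andP[t0 t1]; apply: hd.
    by rewrite /ball/= ltr_distlC; apply/andP; split; lra.
pose A := comb A0 B0 (cosh s0) (sinh s0) 0.
pose B1 := comb A0 B0 (sinh s0) (cosh s0) 0.
have F1 : frame A B1 by exact: frame_shift.
have hn1 : ~ (forall t, L (geo A B1 t)).
  move=> h; apply: (hn L lL) => t; have := h (t - s0).
  by rewrite geo_shift// addrC subrK.
have [B [c [d [F l0 eB1 hcd d0]]]] := adapted_frame F1 lL Lz hn1.
have [M M0 hM] := delta_chart F.
pose K := `|c| / d.
have K0 : 0 <= K by rewrite divr_ge0// ltW.
have K1 : 0 < 1 + K by rewrite ltr_pwDl.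
(* 10h = 400r is the half-length of the vertical chord that carries the target *)
have [N [N0 eN]] : exists N : R, 0 < N /\ N = 400 by exists 400; rewrite ltr0n.
have MN0 : 0 < N * M by rewrite mulr_gt0.
have e1 : 0 < e / (N * M) by rewrite divr_gt0.
have [eta eta0 heta] := hmu _ e1.
(* the sliding arc must stay inside the arc that carries the measure *)
pose tau := Num.min (b - s0) (s0 - a).
have tau0 : 0 < tau by rewrite lt_min !subr_gt0 s0b.
have ttau : 0 < tanh tau by rewrite -(@tanh0 R) tanh_lt.
pose d1 := Num.min (1 / (10 * (N * (1 + K)))) (Num.min (d * tanh tau / 8) (eta / (N * M))).
have d10 : 0 < d1.
  rewrite !lt_min; apply/and3P; split.
  - by rewrite divr_gt0// mulr_gt0// mulr_gt0.
  - by rewrite divr_gt0// mulr_gt0.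
  - by rewrite divr_gt0.
exists d1 => // r r0; rewrite !lt_min => /and3P[r1 r2 r3].
(* tanh r <= 2r = h / 20, the radius that the sliding arc reaches *)
pose h := 40 * r.
have h0 : 0 < h by rewrite mulr_gt0.
have hK : h * (1 + K) < 1 / 100.
  have NK0 : 0 < 10 * (N * (1 + K)) by rewrite mulr_gt0// mulr_gt0.
  by move: r1; rewrite ltr_pdivlMr// eN /h; clear; lra.
have hK0 : 0 <= h * K by rewrite mulr_ge0// ltW.
have hh : h <= 1 / 100 by clear -hK hK0; lra.
have hhK : h * (`|c| / d) <= 1 / 100 by rewrite -/K; clear -hK h0; lra.
have h2 : 100 * h ^+ 2 < 1 by clear -h0 hh; nra.
pose X := Num.sqrt (1 - 100 * h ^+ 2).
have X0 : 0 < X by rewrite sqrtr_gt0 subr_gt0.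
have hX : X ^+ 2 = 1 - 100 * h ^+ 2 by rewrite sqr_sqrtr// subr_ge0 ltW.
have [H [u0 [u1 [v0 [v1 [hH [hu0 hu0'] [hu1 hu1'] v01 [hv0 hv1]]]]]]] :=
  holonomy F l0 hcd d0 h0 hh hhK X0 hX.
set q := 10 * h in hH.
have q0 : 0 < q by rewrite mulr_gt0.
have hq : q ^+ 2 = 1 - X ^+ 2 by rewrite hX /q exprMn -natrX; ring.
have d_le1 : d <= 1 by clear -hcd d0; nra.
have htr : tanh r <= 2 * r by exact/tanh_le2/ltW.
have tr0 : 0 < tanh r by rewrite -(@tanh0 R) tanh_lt.
have dtr : d * tanh r <= h / 20 by rewrite /h; clear -d_le1 d0 tr0 htr; nra.
have ru1 : r <= u1 by rewrite -tanh_le -(ler_pM2l d0); clear -dtr hu1; lra.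
have ru0 : u0 <= - r.
  by rewrite -tanh_le -(ler_pM2l d0) tanhN; clear -dtr hu0'; lra.
have u1tau : u1 <= tau.
  by rewrite -tanh_le -(ler_pM2l d0); move: hu1'; rewrite /h; clear -r2; lra.
have u0tau : - tau <= u0.
  by rewrite -tanh_le -(ler_pM2l d0) tanhN; move: hu0; rewrite /h; clear -r2; lra.
have [tau1 tau2] : tau <= b - s0 /\ tau <= s0 - a by rewrite !ge_min !lexx orbT.
rewrite -eB1 in hH.
have eJ : geo A B1 @` `[u0, u1] = geo A0 B0 @` `[(s0 + u0)%R, (s0 + u1)%R].
  apply/seteqP; split=> [_ [t ht <-]|_ [t ht <-]].
    exists (s0 + t); last by rewrite geo_shift.
    by move: ht; rewrite /= !in_itv/= !lerD2l.
  exists (t - s0); last by rewrite geo_shift// addrC subrK.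
  by move: ht; rewrite /= !in_itv/= lerBrDl lerBlDl.
rewrite eJ in hH.
set J := geo A0 B0 @` _ in hH; set J' := geo _ _ @` _ in hH.
have tJ : transverse_arc (lamination mu) J by apply: tr; clear -ru0 ru1 r0; lra.
have tJ' : transverse_arc (lamination mu) J' by exact: (vertical_transverse F l0).
pose I' := geo (comb A B q^-1 (X / q) 0) (cross A B) @` `[(- (1 / 2))%R, (1 / 2)%R].
have FV := frame_vert F q0 hq.
have half : - (1 / 2) < 1 / 2 :> R by clear; lra.
have tI' : transverse_arc (lamination mu) I' by exact: (vertical_transverse F l0 q0 hq).
have lI' : arc_of_length 1 I'.
  have -> : 1 = 1 / 2 - - (1 / 2) :> R by clear; lra.
  exact: arc_of_length_geo.
have dI' : delta I' <= M * q.
  apply: (hM I' X q (ltW X0) q0 hq); exists 0.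
    by rewrite /= in_itv/=; clear; apply/andP; split; lra.
  by rewrite geo_vert// tanh0 mulr0.
have JI' : J' `<=` I'.
  have th := @tanh_half R; apply: arc_subset.
    by rewrite -tanh_le tanhN; clear -th hv0; lra.
  by rewrite -tanh_le; clear -th hv1; lra.
have JI : J `<=` I.
  by apply: arc_subset; [clear -u0tau tau2|clear -u1tau tau1]; lra.
have mJ : measurable (J : set (borel_plane R)) by exact: arc_measurable.
have mJ' : measurable (J' : set (borel_plane R)) by exact: arc_measurable.
have mI' : measurable (I' : set (borel_plane R)) by exact: arc_measurable.
apply: (@le_trans _ _ (nu J)).
  apply: le_measure; rewrite ?inE//; first exact: arc_measurable.
  by apply: arc_subset; [clear -ru0|clear -ru1]; lra.
have -> : nu J = tmeasure mu J J.
  by rewrite (tmeasure_restrict (tr _ _ ab) tJ JI mJ) setIid.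
rewrite (homotopy_mass tJ tJ' hH) (tmeasure_restrict tI' tJ' JI' mJ') setIid.
apply: (@le_trans _ _ (mass mu I')).
  by apply: le_measure; rewrite ?inE.
have Mq : M * q = N * M * r by rewrite /q /h eN; ring.
apply: le_trans (heta I' tI' lI' _) _.
  apply: le_lt_trans dI' _; by rewrite Mq mulrC -ltr_pdivlMr.
rewrite lee_fin mulrAC ler_pdivrMr// -mulrA ler_pM2l//.
by rewrite mulrC -Mq.
Qed.

End density.

Section total_mass.
Context {R : realType}.
Implicit Types (mu : measured_lamination R).

(** The distribution function n (-1) of the measure on an enlarged arc has derivative
    zero on [-1/2, l]: the arc is enlarged so that the ends of the original one are
    interior points. It is therefore constant there, and the difference of its
    values at -1/2 and l bounds the mass of the original arc. *)
Lemma arc_null mu (hmu : is_little_o_delta mu) A B (l : R) : frame A B -> 0 < l ->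
  (forall L, leaves (lamination mu) L -> ~ (forall t, L (geo A B t))) ->
  tmeasure mu (geo A B @` `[(-1)%R, (l + 1)%R]) (geo A B @` `[0, l]) = 0%E.
Proof.
move=> F l0 hn.
set nu := tmeasure mu _.
pose G (a b : R) : set (borel_plane R) := geo A B @` `[a, b].
have mG a b : measurable (G a b) by exact: arc_measurable.
pose n a b : R := fine (nu (G a b)).
have nE a b : nu (G a b) = (n a b)%:E by rewrite fineK// fin_num_measure.
have n0 a b : 0 <= n a b by rewrite fine_ge0.
have sub a b a' b' : a' <= a -> b <= b' -> G a b `<=` G a' b' by exact: arc_subset.
have nle a b a' b' : a' <= a -> b <= b' -> n a b <= n a' b'.
  by move=> aa bb; rewrite -lee_fin -!nE le_measure ?inE//; exact: sub.
have nsub a b c : a <= b -> n a c <= n a b + n b c.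
  move=> ab; rewrite -lee_fin EFinD -!nE.
  apply: (@le_trans _ _ (nu (G a b `|` G b c))); last exact: measureU2.
  apply: le_measure; rewrite ?inE//; first exact: measurableU.
  move=> _ [t + <-] => /=; rewrite in_itv/= => /andP[t0 t1].
  by case: (leP t b) => tb; [left|right]; exists t => //=; rewrite in_itv/=; apply/andP; split=> //; exact: ltW.
have flat s : - (1 / 2) <= s <= l -> flat_at (n (-1)) s.
  move=> /andP[s0 s1] e e0.
  have [d d0 hd] := @zero_density _ mu hmu A B (-1) (l + 1) s F ltac:(lra) ltac:(lra) hn e e0.
  pose d' := Num.min d (1 / 2).
  exists d'; first by rewrite lt_min d0 divr_gt0.
  move=> t; rewrite lt_min => /andP[t1 t2].
  have [->|ts] := eqVneq t s; first by rewrite !subrr normr0 mulr0.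
  have r0 : 0 < `|t - s| by rewrite normr_gt0 subr_eq0.
  have := hd _ r0 t1; rewrite -/nu nE lee_fin; apply: le_trans.
  have [st|ts'] := leP s t.
    have h1 : n (-1) s <= n (-1) t by apply: nle.
    rewrite (ger0_norm (_ : 0 <= t - s)) ?subr_ge0// ger0_norm ?subr_ge0//.
    have := nsub (-1) s t ltac:(lra).
    by have := nle s t (s - (t - s)) (s + (t - s)) ltac:(lra) ltac:(lra); lra.
  have h1 : n (-1) t <= n (-1) s by apply: nle => //; exact: ltW.
  have t2' : s - t < 1 / 2 by apply: le_lt_trans t2; rewrite distrC ler_norm.
  rewrite distrC (distrC t) (ger0_norm (_ : 0 <= s - t)) ?subr_ge0 ?(ltW ts')//.
  rewrite ger0_norm ?subr_ge0//.
  have := nsub (-1) t s ltac:(lra).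
  by have := nle t s (s - (s - t)) (s + (s - t)) ltac:(lra) ltac:(lra); lra.
have hc := @flat_constant R (n (-1)) (- (1 / 2)) l ltac:(lra) flat.
have disj : G (-1) (- (1 / 2)) `&` G 0 l = set0.
  apply/seteqP; split=> // _ [[t + <-] [t' + /(geo_inj F) e]] => /=.
  rewrite !in_itv/= e => /andP[_ h1] /andP[h2 _]; lra.
have hU : (nu (G (-1)%R (- (1 / 2))%R `|` G 0%R l) <= (n (-1)%R l)%:E)%E.
  rewrite -nE; apply: le_measure; rewrite ?inE//; first exact: measurableU.
  by move=> z [|]; apply: sub; lra.
have eU : nu (G (-1)%R (- (1 / 2))%R `|` G 0%R l) =
    (nu (G (-1)%R (- (1 / 2))%R) + nu (G 0%R l))%E by rewrite measureU.
rewrite eU !nE -EFinD lee_fin hc in hU.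
by rewrite -/(G 0 l) nE; congr EFin; apply/eqP; rewrite eq_le n0 andbT; lra.
Qed.

End total_mass.

Theorem proposition5p1 (R : realType) (mu : measured_lamination R)
  (hmu : is_little_o_delta mu) : trivial_lamination mu.
Proof.
move=> I tI A mA; have [[l [g [l0 hg eI]]] nI] := tI.
have i0 : `[0, l]%classic 0 by rewrite /= in_itv/= lexx ltW.
have i1 : `[0, l]%classic l by rewrite /= in_itv/= lexx ltW.
have [B F hgeo] := unit_speed_geodesicE hg i0 i1 l0.
move: (unit_lift (g 0)) F hgeo => A0 F hgeo.
have {}eI : I = geo A0 B @` `[0, l].
  rewrite eI; apply/seteqP; split=> _ [t ht <-]; exists t => //.
    by rewrite hgeo// subr0.
  by rewrite hgeo// subr0.
have hn L : leaves (lamination mu) L -> ~ (forall t, L (geo A0 B t)).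
  by move=> lL h; apply: nI; exists L => //; rewrite eI => _ [t _ <-]; exact: h.
have tI' : transverse_arc (lamination mu) (geo A0 B @` `[(-1)%R, (l + 1)%R]).
  by rewrite eI in nI; apply: (arc_transverse F l0 nI); lra.
have II' : I `<=` geo A0 B @` `[(-1)%R, (l + 1)%R].
  by rewrite eI; apply: arc_subset; lra.
have mI : measurable (I : set (borel_plane R)) by rewrite eI; exact: arc_measurable.
rewrite (tmeasure_restrict tI' tI II' mA); apply/eqP; rewrite eq_le measure_ge0 andbT.
have <- := arc_null hmu F l0 hn; rewrite -eI.
by apply: le_measure; rewrite ?inE//; exact: measurableI.
Qed.
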